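(* Let $d\ge1$. For each $p<d$ there exist a probability space $(\Omega,\mathcal{F},\mathbb{P})$ endowed with an ergodic group $\tau=(\tau_y)_{y\in\mathbb{R}^d}$ of measure-preserving transformations, and a stationary random field $\lambda:\mathbb{R}^d\times\Omega\to(0,1]$, with almost surely uniformly continuous realizations $\lambda(\cdot,\omega)$ and with a finite range of dependence, such that $$\mathbb{E}\big[\lambda(0,\cdot)^{-p}\big]<+\infty,$$ but for which homogenization fails: the solution $u^\varepsilon=u^\varepsilon(x,\omega)$ of the Dirichlet problem $$\mathcal{P}^-_{\lambda(x/\varepsilon,\omega),1}(D^2u^\varepsilon)=1\ \text{ in }B_1,\qquad u^\varepsilon=0\ \text{ on }\partial B_1,$$ satisfies $$\lim_{\varepsilon\to0}u^\varepsilon(0,\omega)=+\infty\qquad\text{almost surely}.$$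
   Context: $B_1$ is the open unit ball of $\mathbb{R}^d$ centered at the origin. For a symmetric $d\times d$ matrix $M=M_+-M_-$ with $M_\pm\ge0$, $M_+M_-=0$, and $0<\mu\le1$, $\mathcal{P}^-_{\mu,1}(M)=-\mathrm{tr}(M_+)+\mu\,\mathrm{tr}(M_-)$. Solutions are understood in the viscosity sense. The group $\tau$ is an action of $\mathbb{R}^d$ on $\Omega$ by measurable maps with $\mathbb{P}[\tau_yA]=\mathbb{P}[A]$ for all $A\in\mathcal{F}$, $y\in\mathbb{R}^d$; it is ergodic if $\tau_yA=A$ for every $y$ implies $\mathbb{P}[A]\in\{0,1\}$. The field $\lambda$ is stationary if $\lambda(y,\tau_z\omega)=\lambda(y+z,\omega)$ for all $y,z\in\mathbb{R}^d$ and $\omega \in \Omega$. Finite range of dependence means: there is a constant $\ell>0$ such that, whenever $V,W\subseteq\mathbb{R}^d$ satisfy $\mathrm{dist}(V,W)\ge\ell$, the $\sigma$-algebras generated by $\{\lambda(y,\cdot):y\in V\}$ and $\{\lambda(y,\cdot):y\in W\}$ are independent. *)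

(* Defs.v *)
From HB Require Import structures.
From mathcomp Require Import all_boot all_order all_algebra.
From mathcomp Require Import all_classical all_reals all_analysis.

Set Implicit Arguments.
Unset Strict Implicit.
Unset Printing Implicit Defensive.

Import Order.TTheory GRing.Theory Num.Theory.
Import numFieldNormedType.Exports.

Local Open Scope classical_set_scope.
Local Open Scope ring_scope.

Section Euclidean.
Context {R : realType} {d : nat}.
Implicit Types (x y : 'rV[R]_d) (V W : set 'rV[R]_d).

(* The library norm on 'rV[R]_d is the sup norm. It induces the usual topology
   and uniform structure, but balls and distances need the Euclidean norm. *)
Definition enorm x : R := Num.sqrt (\sum_i x ord0 i ^+ 2).

Definition unit_ball : set 'rV[R]_d := [set x | enorm x < 1].

Definition unit_sphere : set 'rV[R]_d := [set x | enorm x = 1].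

Definition closed_unit_ball : set 'rV[R]_d := [set x | enorm x <= 1].

(* Equal to +oo when V or W is empty. *)
Definition set_dist V W : \bar R :=
  ereal_inf [set (enorm (x - y))%:E | x in V & y in W].

End Euclidean.

Section Pucci.
Context {R : realType} {d : nat}.
Implicit Types M A : 'M[R]_d.

Definition psd A : Prop :=
  A^T = A /\ forall x : 'rV[R]_d, 0 <= (x *m A *m x^T) ord0 ord0.

Definition pos_neg_decomp M (N : 'M[R]_d * 'M[R]_d) : Prop :=
  [/\ psd N.1, psd N.2, N.1 *m N.2 = 0 & M = N.1 - N.2].

(* The pair (M_+, M_-). The decomposition exists and is unique for symmetric M;
   the default value (0, 0) is taken only when M is not symmetric. *)
Definition pos_neg_parts M : 'M[R]_d * 'M[R]_d :=
  xget (0, 0) [set N | pos_neg_decomp M N].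

(* The extremal operator P^-_{mu,1}. *)
Definition pucci_minus (mu : R) M : R :=
  - \tr (pos_neg_parts M).1 + mu * \tr (pos_neg_parts M).2.

End Pucci.

Section Viscosity.
Context {R : realType} {d : nat}.
Implicit Types (u phi : 'rV[R]_d -> R) (U : set 'rV[R]_d).

Definition partial (i : 'I_d) phi : 'rV[R]_d -> R :=
  'D_(delta_mx ord0 i) phi.

Definition hessian phi (x : 'rV[R]_d) : 'M[R]_d :=
  \matrix_(i, j) partial j (partial i phi) x.

(* phi is of class C^2 on U, which is meant to be open. *)
Definition C2_on U phi : Prop :=
  forall x, U x ->
    [/\ {for x, continuous phi},
        forall i, derivable phi x (delta_mx ord0 i) /\
                  {for x, continuous (partial i phi)} &
        forall i j, derivable (partial i phi) x (delta_mx ord0 j) /\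
                    {for x, continuous (partial j (partial i phi))}].

Definition local_max_at (f : 'rV[R]_d -> R) (x : 'rV[R]_d) : Prop :=
  \forall y \near x, f y <= f x.

Definition local_min_at (f : 'rV[R]_d -> R) (x : 'rV[R]_d) : Prop :=
  \forall y \near x, f x <= f y.

(* F (x, D^2 u) <= f, resp. >= f, in the viscosity sense in the open set U, for
   F nonincreasing in its matrix argument (as pucci_minus mu is). Semicontinuity
   is not part of these definitions: they are only used for continuous u. *)
Definition viscosity_sub (F : 'rV[R]_d -> 'M[R]_d -> R) (f : 'rV[R]_d -> R)
    U u : Prop :=
  forall phi x, C2_on U phi -> U x -> local_max_at (u \- phi) x ->
    F x (hessian phi x) <= f x.

Definition viscosity_super (F : 'rV[R]_d -> 'M[R]_d -> R) (f : 'rV[R]_d -> R)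
    U u : Prop :=
  forall phi x, C2_on U phi -> U x -> local_min_at (u \- phi) x ->
    f x <= F x (hessian phi x).

(* u solves P^-_{mu(x),1}(D^2 u) = 1 in B_1 and u = 0 on the boundary of B_1.
   The values of u outside the closed ball are irrelevant. *)
Definition dirichlet_solution (mu : 'rV[R]_d -> R) u : Prop :=
  [/\ {within closed_unit_ball, continuous u},
      viscosity_sub (fun x M => pucci_minus (mu x) M) (fun=> 1) unit_ball u,
      viscosity_super (fun x M => pucci_minus (mu x) M) (fun=> 1) unit_ball u &
      forall x, unit_sphere x -> u x = 0].

End Viscosity.

Section RandomEnvironment.
Context {R : realType} {d : nat} {disp : measure_display}
        {Omega : measurableType disp}.
Implicit Types (P : probability Omega R) (tau : 'rV[R]_d -> Omega -> Omega)
  (lambda : 'rV[R]_d -> Omega -> R).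

Definition measure_preserving_action P tau : Prop :=
  [/\ forall w, tau 0 w = w,
      forall y z w, tau (y + z) w = tau y (tau z w),
      forall y, measurable_fun setT (tau y) &
      forall y A, measurable A -> P (tau y @` A) = P A].

Definition ergodic P tau : Prop :=
  forall A, measurable A -> (forall y, tau y @` A = A) ->
    P A = 0%E \/ P A = 1%E.

Definition stationary tau lambda : Prop :=
  forall y z w, lambda y (tau z w) = lambda (y + z) w.

Definition sigma_field lambda (V : set 'rV[R]_d) : set_system Omega :=
  <<s \bigcup_(y in V) preimage_set_system setT (lambda y) measurable >>.

Definition independent_systems P (G H : set_system Omega) : Prop :=
  forall A B, G A -> H B -> P (A `&` B) = (P A * P B)%E.

Definition finite_range_dependence P lambda : Prop :=
  exists2 l : R, 0 < l &
    forall V W : set 'rV[R]_d, (l%:E <= set_dist V W)%E ->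
      independent_systems P (sigma_field lambda V) (sigma_field lambda W).

End RandomEnvironment.

(* Main.v *)
Require Import Defs.
From HB Require Import structures.
From mathcomp Require Import all_boot all_order all_algebra.
From mathcomp Require Import all_classical all_reals all_analysis.
From mathcomp Require Import measurable_realfun.
From mathcomp Require Import ring lra zify.
Import Order.TTheory GRing.Theory Num.Theory.
Import numFieldNormedType.Exports.
Set Implicit Arguments.
Unset Strict Implicit.
Unset Printing Implicit Defensive.
Local Open Scope classical_set_scope.
Local Open Scope ring_scope.

(** The random field is the lower envelope of Poisson wells. The points of a
    Poisson process carry a place in R^d and a depth h whose distribution
    function is h |-> h^q, where p < q < d. The well of a point is flat of height
    h on the cube of radius r around the place and grows with slope 1 outside of
    it. The field is the minimum of all wells and of a small constant lam. It is
    1-Lipschitz and positive, and its value at a point depends only on the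
    Poisson points in a bounded neighbourhood.

    Failure of homogenization. The ball of radius 1 / eps contains about eps^-d
    unit cubes, so that its lowest well has depth about eps^(d / q), which is much
    smaller than eps. Almost surely, for all small eps, there is a trap of depth
    h <= (2 eps)^beta near the origin, for a fixed beta in (1, d / q) (lemma
    almost_surely_traps). The operator P^-_{mu,1} is the minimum of - tr (A M) over
    mu I <= A <= I, so that the solution is the largest expected exit time over
    all controlled diffusions with such matrices. As mu <= lam is small, the
    control may diffuse almost only in the direction of the trap. Seen from the
    trap such a diffusion has effective dimension close to 1, hence reaches the
    trap, and it then spends a time of order eps^(2 - 2 a) / h before leaving,
    with 2 a as close to 1 as desired. This tends to infinity if
    beta + 2 a > 2. The rigorous form is an explicit smooth strict subsolution
    (barrier), compared with the solution at an interior minimum of the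
    difference (comparison, pucci_barrier, solution_lower_bound).

    The probability space. All information about the field is contained in the
    events that it exceeds given levels at finitely many points. Such an event
    says that the Poisson process has no point in an explicit finite union of
    boxes, hence has probability exp (- volume) (env_law_exists). Translation
    invariance of the volume gives stationarity, its additivity on disjoint sets
    gives independence at a distance, and independence at a distance gives mixing
    and ergodicity. The law is put on the space of admissible fields, with the
    sigma-algebra generated by evaluations and with the shifts as action.

    The Poisson process is built from a single uniform variable. Its binary digits
    are fair coins, and the coins of even and of odd index are two independent
    copies of the sequence (coin_measure_independent). Iterating the splitting
    provides independent seeds for the unit cells, and from each seed a Poisson
    number of independent uniform points in its cell. *)

(** * Measures: image measures, independence, affine maps of the line *)

Section push.
Context d d' (T : measurableType d) (T' : measurableType d') (R : realType).
Variables (m : {measure set T -> \bar R}) (f : T -> T').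
Hypothesis mf : measurable_fun setT f.

Lemma pushforward_measure_exists :
  exists m' : {measure set T' -> \bar R}, forall A, m' A = m (f @^-1` A).
Proof. by exists (measure_function_pushforward__canonical__measure_function_Measure m mf). Qed.
End push.

Section law.
Context d d' (T : measurableType d) (T' : measurableType d') (R : realType).
Variables (m : {measure set T -> \bar R}) (m1 : m setT = 1%E).

(** A copy of m that carries the probability structure, so that the structure
    can depend on the proof that the total mass is one. *)
Definition probability_copy of m setT = 1%E : set T -> \bar R := m.
HB.instance Definition _ := Measure.copy (probability_copy m1) m.
HB.instance Definition _ := Measure_isProbability.Build _ _ _ (probability_copy m1) m1.

Lemma probability_of_measure : exists P : probability T R, forall A, P A = m A.
Proof. by exists (probability_copy m1). Qed.
End law.

Section independence.
Context d (T : measurableType d) (R : realType) (P : probability T R).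
Implicit Types (G H : set_system T) (A B : set T).
Local Open Scope ereal_scope.

(** For fixed B both A |-> P (A `&` B) and A |-> P A * P B are finite
    measures, so that they agree on a generated sigma-algebra as soon as they
    agree on a pi-system. *)
Lemma independent_of_pi_system G B :
  G `<=` measurable -> setI_closed G -> G setT -> measurable B ->
  (forall A, G A -> P (A `&` B) = P A * P B) ->
  forall A, <<s G >> A -> P (A `&` B) = P A * P B.
Proof.
move=> Gm GI GT mB GB A sA.
have PB0 : (0 <= fine (P B))%R by apply: fine_ge0.
pose m1 : {measure set T -> \bar R} := mrestr P mB.
pose m2 : {measure set T -> \bar R} := mscale (NngNum PB0) P.
have E2 X : m2 X = P X * P B.
  by rewrite /m2 /= /mscale /= fineK ?fin_num_measure// muleC.
rewrite -E2.
apply: (@g_sigma_algebra_measure_unique _ _ _ G Gm (fun=> setT) _ _ m1 m2) => //.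
- by rewrite bigcup_const.
- by move=> X GX; rewrite E2 -GB.
- by move=> _; rewrite /m1 /= /mrestr setTI -ge0_fin_numE// fin_num_measure.
Qed.

Lemma independent_of_pi_systems G H :
  G `<=` measurable -> setI_closed G -> G setT ->
  H `<=` measurable -> setI_closed H -> H setT ->
  (forall A B, G A -> H B -> P (A `&` B) = P A * P B) ->
  forall A B, <<s G >> A -> <<s H >> B -> P (A `&` B) = P A * P B.
Proof.
move=> Gm GI GT Hm HI HT GH A B sA sB.
have sG := smallest_sub (@sigma_algebra_measurable _ T) Gm.
rewrite setIC muleC; apply: (independent_of_pi_system Hm) => //; first exact: sG.
move=> {sB}B HB; rewrite setIC muleC.
apply: (independent_of_pi_system Gm) => //; first exact: Hm.
by move=> {sA}A GA; exact: GH.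
Qed.
End independence.

Lemma lebesgue_measure_affine (R : realType) (a b : R) (A : set R) : (0 < a)%R ->
  measurable A ->
  lebesgue_measure A = (a%:E * lebesgue_measure ((fun x : R => a * x + b)%R @^-1` A))%E.
Proof.
move=> a0 mA.
have mf : measurable_fun setT (fun x : measurableTypeR R => (a * x + b)%R : measurableTypeR R).
  by apply: measurable_realfun.measurable_funD => //; exact: measurable_funM.
pose f := measure_function_pushforward__canonical__measure_function_Measure
   (@lebesgue_measure R) mf.
pose m : {measure set (measurableTypeR R) -> \bar R} := mscale (NngNum (ltW a0)) f.
have -> : lebesgue_measure A = m A.
  apply: lebesgue_measure_unique => // _ [[u v]] _ <-.
  rewrite /m /= /mscale /= /f /= /pushforward /=.
  have -> : (fun x : R => a * x + b)%R @^-1` `]u, v] = `](u - b) / a, (v - b) / a]%classic.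
    apply/seteqP; split=> x /=; rewrite !in_itv /= => /andP[h1 h2].
      rewrite ltr_pdivrMr// ler_pdivlMr//; apply/andP; split; nra.
    move: h1 h2; rewrite ltr_pdivrMr// ler_pdivlMr// => h1 h2; apply/andP; split; nra.
  rewrite !lebesgue_measure_itv /= !lte_fin.
  rewrite ltr_pM2r ?invr_gt0// ltrD2r.
  case: ifPn => _; last by rewrite mule0.
  by rewrite -!EFinB -EFinM; congr EFin; field; rewrite gt_eqF.
by rewrite /m /= /mscale.
Qed.

(** * Coin tossing from binary digits *)

(** The constraints on the coins beyond n are absent, so that these boxes are
    stable under intersection without any bookkeeping of index sets. *)
Definition coin_cylinder : set_system (nat -> bool) :=
  [set B | exists n (A : nat -> set bool), B = [set b | forall i, (i < n)%N -> A i (b i)]].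

Definition coins : Type := g_sigma_algebraType coin_cylinder.
HB.instance Definition _ := Measurable.on coins.

Lemma coin_cylinderT : coin_cylinder setT.
Proof. by exists 0%N, (fun=> setT); apply/seteqP; split. Qed.

Lemma coin_cylinderI : setI_closed coin_cylinder.
Proof.
move=> _ _ [n [A ->]] [m [B ->]].
exists (maxn n m), (fun i => [set c | ((i < n)%N -> A i c) /\ ((i < m)%N -> B i c)]).
apply/seteqP; split => b /=.
  by move=> [hA hB] i _; split=> [/hA|/hB].
move=> h; split=> i lti; apply h => //.
- by rewrite leq_max lti.
- by rewrite leq_max lti orbT.
Qed.

Lemma measurable_coin_cylinder (B : set coins) : coin_cylinder B -> measurable B.
Proof. exact: sub_sigma_algebra. Qed.

Lemma measurable_coin n : measurable_fun setT (fun b : coins => b n : bool).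
Proof.
move=> _ Y mY; rewrite setTI; apply: measurable_coin_cylinder.
exists n.+1, (fun i => [set c | i = n -> Y c]); apply/seteqP; split=> b /=.
  by move=> h i _ ->.
by move=> h; exact: (h n).
Qed.

Section bits.
Context {R : realType}.
Implicit Types (x : R) (A : nat -> set bool).

Definition double_mod1 x : R := if 2^-1 <= x then 2 * x - 1 else 2 * x.

(** The binary digits of x in `[0, 1[, read off along the orbit of the
    doubling map. *)
Fixpoint bit n x : bool :=
  if n is n'.+1 then bit n' (double_mod1 x) else 2^-1 <= x.

Lemma measurable_double_mod1 : measurable_fun setT double_mod1.
Proof.
apply: measurable_fun_ifT.
- exact: measurable_fun_ler.
- by apply: measurable_funB => //; exact: measurable_funM.
- exact: measurable_funM.
Qed.

Lemma measurable_bit n : measurable_fun setT (bit n).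
Proof.
elim: n => [|n ih]; first exact: measurable_fun_ler.
exact: measurableT_comp ih measurable_double_mod1.
Qed.

Definition bits x : coins := fun n => bit n x.

Lemma measurable_bits : measurable_fun setT bits.
Proof.
apply: (@measurability _ _ _ _ setT bits coin_cylinder erefl) => _ [_ [n [A ->]] <-]; rewrite setTI.
rewrite (_ : _ @^-1` _ = \bigcap_(i < n) (bit i @^-1` A i)); last by [].
apply: bigcap_measurableType => i _.
by rewrite -[X in measurable X]setTI; exact: measurable_bit.
Qed.

Definition fair_coin (B : set bool) : R := 2^-1 * (\1_B false + \1_B true).

Definition uniform_measure : set (measurableTypeR R) -> \bar R :=
  mrestr (@lebesgue_measure R) (measurable_itv `[0%R, 1%R[).
HB.instance Definition _ := Measure.on uniform_measure.

Lemma uniform_measureT : uniform_measure setT = 1%E.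
Proof.
rewrite /uniform_measure /mrestr setTI lebesgue_measure_itv /= lte_fin ltr01.
by rewrite oppr0 adde0.
Qed.

(** The uniform law is the fixed point of the two inverse branches of the
    doubling map. This self-similarity is what makes the digits fair and
    independent. *)
Lemma uniform_measure_halves (A : set R) : measurable A ->
  uniform_measure A = (2^-1%:E * uniform_measure ((fun x => 2^-1 * x + 0)%R @^-1` A)
    + 2^-1%:E * uniform_measure ((fun x => 2^-1 * x + 2^-1)%R @^-1` A))%E.
Proof.
move=> mA; rewrite /uniform_measure /mrestr.
have -> : A `&` `[0, 1[ = (A `&` `[0, 2^-1[) `|` (A `&` `[2^-1, 1[).
  apply/seteqP; split => x /=; rewrite !in_itv /=.
    move=> [Ax /andP[x0 x1]]; have [h|h] := ltP x 2^-1; [left|right].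
      by split => //; rewrite x0.
    by split => //; rewrite x1.
  by move=> [] [Ax /andP[x0 x1]]; split => //; apply/andP; split => //; lra.
rewrite measureU//; first last.
- rewrite -subset0 => x /=; rewrite !in_itv /=.
  by move=> [[_ /andP[_ h1]] [_ /andP[h2 _]]]; lra.
- exact: measurableI.
- exact: measurableI.
have h2 : (0 < 2^-1 :> R) by [].
have mh (b : R) : measurable ((fun x : R => 2^-1 * x + b) @^-1` A).
  rewrite -[X in measurable X]setTI.
  apply: (_ : measurable_fun setT _) => //.
  by apply: measurable_funD => //; exact: measurable_funM.
congr (_ + _)%E.
  apply: (etrans (lebesgue_measure_affine 0 h2 _)); first exact: measurableI.
  congr (_ * lebesgue_measure _)%E; apply/seteqP; split=> x /=; rewrite !in_itv /=.
    by move=> [Ax /andP[x0 x1]]; split => //; apply/andP; split; lra.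
  by move=> [Ax /andP[x0 x1]]; split => //; apply/andP; split; lra.
apply: (etrans (lebesgue_measure_affine 2^-1 h2 _)); first exact: measurableI.
congr (_ * lebesgue_measure _)%E; apply/seteqP; split=> x /=; rewrite !in_itv /=.
  by move=> [Ax /andP[x0 x1]]; split => //; apply/andP; split; lra.
by move=> [Ax /andP[x0 x1]]; split => //; apply/andP; split; lra.
Qed.

Lemma eq_uniform_measure (A B : set R) : (forall x, 0 <= x < 1 -> A x <-> B x) ->
  uniform_measure A = uniform_measure B.
Proof.
move=> AB; rewrite /uniform_measure /mrestr; congr lebesgue_measure.
apply/seteqP; split => x /=; rewrite in_itv /= => -[h x01]; split => //; exact/(AB x).
Qed.

(** Induction on n: on each half of the unit interval the first digit is
    constant and the remaining digits are the digits of the doubled point. *)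
Lemma uniform_measure_bits n A :
  uniform_measure [set x | forall i, (i < n)%N -> A i (bit i x)] =
  (\prod_(i < n) fair_coin (A i))%:E.
Proof.
elim: n A => [|n ih] A.
  rewrite big_ord0 (_ : [set _ | _] = setT) ?uniform_measureT//.
  by apply/seteqP; split.
rewrite uniform_measure_halves; last first.
  rewrite -[X in measurable X]setTI.
  have := measurable_bits measurableT (@measurable_coin_cylinder [set b | forall i, (i < n.+1)%N -> A i (b i)] _).
  by apply; exists n.+1, A.
have E c : uniform_measure ((fun x : R => 2^-1 * x + (if c then 2^-1 else 0))%R
     @^-1` [set x | forall i, (i < n.+1)%N -> A i (bit i x)]) =
     ((\1_(A 0%N) c)%:E * (\prod_(i < n) fair_coin (A i.+1))%:E)%E.
  rewrite indicE; have [Ac|Ac] := pselect (A 0%N c).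
    rewrite mem_set// mul1e -(ih (fun i => A i.+1)); apply: eq_uniform_measure => x /andP[x0 x1] /=.
    have b0 : bit 0 (2^-1 * x + (if c then 2^-1 else 0)) = c.
      by rewrite /=; case: (c) => /=; [apply/idP|apply/negbTE; rewrite -ltNge]; lra.
    have d0 : double_mod1 (2^-1 * x + (if c then 2^-1 else 0)) = x.
      by move: b0; rewrite /double_mod1 /= => ->; case: (c); field.
    split=> h i lti; first by have := h i.+1 lti; rewrite /= d0.
    by case: i lti => [|i] lti; rewrite ?b0//= d0; exact: h.
  rewrite memNset// mul0e.
  rewrite -[RHS](measure0 uniform_measure); apply: eq_uniform_measure => x /andP[x0 x1] /=.
  split=> // /(_ 0%N (ltn0Sn _)).
  have -> //: bit 0 (2^-1 * x + (if c then 2^-1 else 0)) = c.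
  by rewrite /=; case: (c) => /=; [apply/idP|apply/negbTE; rewrite -ltNge]; lra.
have := E false; have := E true => /= -> ->.
by rewrite big_ord_recl /fair_coin -!EFinM -EFinD; congr EFin; ring.
Qed.

End bits.

(** * One coin sequence contains two independent ones *)

Section seeds.
Context {R : realType}.
Implicit Types (x : R) (b : coins).

Definition evens (b : coins) : coins := fun i => b i.*2.
Definition odds (b : coins) : coins := fun i => b i.*2.+1.

Lemma measurable_reindex_coins (s : nat -> nat) :
  measurable_fun setT (fun b : coins => (fun i => b (s i)) : coins).
Proof.
apply: (@measurability _ _ coins coins setT
  (fun b : coins => (fun i => b (s i)) : coins) coin_cylinder erefl) => _ [_ [n [A ->]] <-].
rewrite setTI.
rewrite (_ : _ @^-1` _ = \bigcap_(i < n) ((fun b : coins => b (s i)) @^-1` A i)) //.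
apply: bigcap_measurableType => i _.
by rewrite -[X in measurable X]setTI; exact: measurable_coin.
Qed.

Lemma prod_double (F : nat -> R) n :
  \prod_(i < n.*2) F i = (\prod_(i < n) F i.*2) * (\prod_(i < n) F i.*2.+1).
Proof.
elim: n => [|n ih]; first by rewrite !big_ord0 mulr1.
by rewrite doubleS !big_ord_recr /= ih; ring.
Qed.

Definition binary_sum n b : R := \sum_(i < n) 2^-1 ^+ i.+1 * (b i)%:R.

Lemma binary_sumS n b : binary_sum n.+1 b =
  2^-1 * (b 0%N)%:R + 2^-1 * binary_sum n (fun i => b i.+1).
Proof.
rewrite /binary_sum big_ord_recl expr1 mulr_sumr; congr (_ + _).
by apply: eq_bigr => i _; rewrite exprS mulrA.
Qed.

(** Truncating the binary expansion after n digits leaves an error between 0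
    and 2^-n, by induction along the doubling map. *)
Lemma binary_sum_bits n x : 0 <= x < 1 ->
  0 <= x - binary_sum n (bits x) <= 2^-1 ^+ n.
Proof.
elim: n x => [|n ih] x /andP[x0 x1].
  by rewrite /binary_sum big_ord0 subr0 expr0 x0 ltW.
have d01 : 0 <= double_mod1 x < 1.
  rewrite /double_mod1; case: ifPn => [|/negP]; first by move=> h; apply/andP; split; lra.
  by move=> /negP; rewrite -ltNge => h; apply/andP; split; lra.
rewrite binary_sumS exprS.
have -> : (fun i => bits x i.+1) = bits (double_mod1 x) by [].
have := ih _ d01; set s := binary_sum _ _; set h := 2^-1 ^+ n.
rewrite /double_mod1 /bits /=; case: ifPn => _ /andP[h1 h2] /=; apply/andP; split; lra.
Qed.

Lemma cvg_binary_sum b : binary_sum ^~ b @ \oo --> limn (binary_sum ^~ b).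
Proof.
apply: nondecreasing_is_cvgn.
  apply/nondecreasing_seqP => n; rewrite /binary_sum big_ord_recr /= lerDl.
  by rewrite mulr_ge0.
exists 1 => _ [n _ <-].
suff : binary_sum n b <= 1 - 2^-1 ^+ n.
  by move=> /le_trans; apply; rewrite lerBlDr lerDl exprn_ge0.
elim: n b => [|n ih] b; first by rewrite /binary_sum big_ord0 expr0 subrr.
rewrite binary_sumS exprS.
have := ih (fun i => b i.+1); set h := _ ^+ n; set t := binary_sum _ _ => h1.
by case: (b 0%N) => /=; lra.
Qed.

(** The sequence that is constantly true has sum 1; it is sent to 0 in order
    that every value lies in `[0, 1[. *)
Definition uniform_of_coins b : R :=
  let t := limn (binary_sum ^~ b) in if (0 <= t) && (t < 1) then t else 0.

Lemma uniform_of_coins01 b : 0 <= uniform_of_coins b < 1.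
Proof. by rewrite /uniform_of_coins /=; case: ifPn => //; rewrite lexx ltr01. Qed.

Lemma measurable_uniform_of_coins : measurable_fun setT uniform_of_coins.
Proof.
have ml : measurable_fun setT (fun b : coins => limn (binary_sum ^~ b) : R).
  apply: (@measurable_fun_cvg _ _ _ _ (fun n (b : coins) => binary_sum n b)).
    move=> n; apply: measurable_sum => i; apply: measurable_funM => //.
    rewrite (_ : (fun b : coins => (b i)%:R) = (fun c : bool => c%:R) \o (fun b : coins => b i))//.
    by apply: measurableT_comp => //; exact: measurable_coin.
  by move=> b _; exact: cvg_binary_sum.
apply: measurable_fun_ifT => //.
by apply: measurable_and; [exact: measurable_fun_ler|exact: measurable_fun_ltr].
Qed.

Lemma uniform_of_coins_bits x : 0 <= x < 1 -> uniform_of_coins (bits x) = x.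
Proof.
move=> x01; rewrite /uniform_of_coins.
suff -> : limn (binary_sum ^~ (bits x)) = x by rewrite x01.
apply/cvg_lim => //.
apply: (@squeeze_cvgr _ _ _ _ (fun n => x - 2^-1 ^+ n) (fun=> x)).
- near=> n; have /andP[h1 h2] := binary_sum_bits n x01; apply/andP; split; lra.
- rewrite -[X in _ --> X]subr0; apply: cvgB; first exact: cvg_cst.
  by apply: cvg_expr; rewrite ger0_norm //; lra.
- exact: cvg_cst.
Unshelve. all: by end_near. Qed.

Lemma coin_measure_exists : exists P : probability coins R,
  forall A, P A = uniform_measure (bits @^-1` A).
Proof.
have [m mE] := pushforward_measure_exists (@uniform_measure R) (@measurable_bits R).
have m1 : m setT = 1%E by rewrite mE preimage_setT; exact: uniform_measureT.
have [P PE] := probability_of_measure m1.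
by exists P => A; rewrite PE mE.
Qed.

Section coin_measure.
Variable P : probability coins R.
Hypothesis PE : forall A, P A = uniform_measure (bits @^-1` A).
Local Open Scope ereal_scope.

Lemma coin_measure_cylinder n (A : nat -> set bool) :
  P [set b | forall i, (i < n)%N -> A i (b i)] = (\prod_(i < n) fair_coin (A i))%:E.
Proof. by rewrite PE -uniform_measure_bits. Qed.

(** On `[0, 1[ the expansion map inverts the digit map, so that the law of the
    expansion is the uniform law from which the digits were drawn. *)
Lemma coin_measure_uniform (A : set R) : measurable A ->
  P (uniform_of_coins @^-1` A) = uniform_measure A.
Proof.
move=> mA; rewrite PE; apply: eq_uniform_measure => x x01 /=.
by rewrite uniform_of_coins_bits.
Qed.

Lemma coin_cylinder_pad n m (A : nat -> set bool) : (n <= m)%N ->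
  [set b : coins | forall i, (i < n)%N -> A i (b i)] =
  [set b | forall i, (i < m)%N -> [set c | (i < n)%N -> A i c] (b i)].
Proof.
move=> nm; apply/seteqP; split=> b /= h i; first by move=> _; exact: h.
by move=> lti; apply: h => //; exact: leq_trans nm.
Qed.

(** Constraints on the even coins and on the odd coins interleave into a
    single cylinder, whose probability is a product. *)
Lemma coin_measure_split_cylinder n (A B : nat -> set bool) :
  P (evens @^-1` [set b | forall i, (i < n)%N -> A i (b i)] `&`
     odds @^-1` [set b | forall i, (i < n)%N -> B i (b i)]) =
  P [set b | forall i, (i < n)%N -> A i (b i)] *
  P [set b | forall i, (i < n)%N -> B i (b i)].
Proof.
rewrite (_ : _ `&` _ = [set b | forall i, (i < n.*2)%N ->
    (if odd i then B i./2 else A i./2) (b i)]); last first.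
  apply/seteqP; split=> b /=.
    move=> [hA hB] i lti; have := odd_double_half i; case: ifPn => oi Ei.
      by rewrite -{2}Ei; apply: hB; rewrite ltn_half_double.
    by rewrite -{2}Ei; apply: hA; rewrite ltn_half_double.
  move=> h; split=> i lti.
    have := h i.*2; rewrite ltn_double odd_double doubleK; exact.
  have := h i.*2.+1; rewrite /= odd_double /= uphalf_double; apply.
  by rewrite ltn_Sdouble.
rewrite !coin_measure_cylinder -EFinM.
apply: (etrans (coin_measure_cylinder n.*2 (fun i => if odd i then B i./2 else A i./2))).
congr EFin.
rewrite (prod_double (fun i => fair_coin (if odd i then B i./2 else A i./2))).
congr (_ * _)%R; apply: eq_bigr => i _; first by rewrite odd_double doubleK.
by rewrite /= odd_double /= uphalf_double.
Qed.

Lemma coin_measure_split A B : coin_cylinder A -> coin_cylinder B ->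
  P (evens @^-1` A `&` odds @^-1` B) = P A * P B.
Proof.
move=> [n [A' ->]] [m [B' ->]].
rewrite (coin_cylinder_pad A' (leq_maxl n m)) (coin_cylinder_pad B' (leq_maxr n m)).
exact: (coin_measure_split_cylinder (maxn n m)
  (fun i => [set c | (i < n)%N -> A' i c]) (fun i => [set c | (i < m)%N -> B' i c])).
Qed.

Lemma coin_measure_image (f : coins -> coins) : measurable_fun setT f ->
  (forall A, coin_cylinder A -> P (f @^-1` A) = P A) ->
  forall A, measurable A -> P (f @^-1` A) = P A.
Proof.
move=> mf fP A mA.
have [m mE] := @pushforward_measure_exists _ _ _ _ _ P f mf.
rewrite -mE.
apply: (@measure_unique _ R coins coin_cylinder (fun=> setT) erefl coin_cylinderI
  _ _ m P _ _ A mA).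
- by move=> _; exact: coin_cylinderT.
- by rewrite bigcup_const.
- by move=> B cB; exact: (etrans (mE _) (fP _ cB)).
- by move=> _; rewrite [X in (X < _)%E]mE preimage_setT [X in (X < _)%E]probability_setT ltry.
Qed.

Lemma coin_measure_evens A : measurable A -> P (evens @^-1` A) = P A.
Proof.
apply: coin_measure_image; first exact: measurable_reindex_coins.
move=> B cB; have := coin_measure_split cB coin_cylinderT.
by rewrite preimage_setT setIT probability_setT mule1.
Qed.

Lemma coin_measure_odds A : measurable A -> P (odds @^-1` A) = P A.
Proof.
apply: coin_measure_image; first exact: measurable_reindex_coins.
move=> B cB; have := coin_measure_split coin_cylinderT cB.
by rewrite preimage_setT setTI probability_setT mul1e.
Qed.

Lemma preimage_pi_system (f : coins -> coins) :
  measurable_fun setT f ->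
  let G := preimage_set_system setT f coin_cylinder in
  [/\ G `<=` measurable, setI_closed G, G setT &
      forall A, measurable A -> <<s G >> (f @^-1` A)].
Proof.
move=> mf G; split.
- move=> _ [A cA <-]; apply: mf => //; exact: measurable_coin_cylinder.
- move=> _ _ [A cA <-] [B cB <-]; exists (A `&` B); first exact: coin_cylinderI.
  by rewrite !setTI preimage_setI.
- by exists setT; [exact: coin_cylinderT|rewrite setTI preimage_setT].
- by move=> A mA; rewrite g_sigma_preimageE; exists A => //; rewrite setTI.
Qed.

(** The even and the odd coins are two independent copies of the whole
    sequence. Iterating this splitting yields arbitrarily many independent
    uniform variables, and so replaces an infinite product of probability
    spaces. *)
Lemma coin_measure_independent A B : measurable A -> measurable B ->
  P (evens @^-1` A `&` odds @^-1` B) = P A * P B.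
Proof.
move=> mA mB; rewrite -(coin_measure_evens mA) -(coin_measure_odds mB).
(* double and succn \o double are the index maps of evens and odds. *)
have [Gm GI GT GA] := preimage_pi_system (measurable_reindex_coins double).
have [Hm HI HT HA] := preimage_pi_system (measurable_reindex_coins (succn \o double)).
apply: (independent_of_pi_systems Gm GI GT Hm HI HT); [|exact: GA|exact: HA].
move=> _ _ [C cC <-] [D cD <-]; rewrite !setTI.
have mC := measurable_coin_cylinder cC; have mD := measurable_coin_cylinder cD.
by rewrite [LHS](coin_measure_split cC cD) -(coin_measure_evens mC) -(coin_measure_odds mD).
Qed.

End coin_measure.
End seeds.

(** * Independent seeds and the Poisson process in one cell *)

Section poisson.
Context d (T : measurableType d) (R : realType) (P : probability T R).
Variables (f g : T -> T) (u : T -> R).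
Hypotheses (mf : measurable_fun setT f) (mg : measurable_fun setT g).
Hypothesis fgP : forall A B, measurable A -> measurable B ->
  (P (f @^-1` A `&` g @^-1` B) = P A * P B)%E.
Hypotheses (mu : measurable_fun setT u) (u01 : forall t, 0 <= u t < 1).
Hypothesis uP : forall A : set R, measurable A -> P (u @^-1` A) = uniform_measure A.

(** Splitting off f and continuing with g: if f and g extract two independent
    copies of the sample, these are independent copies of the sample, one for
    each n. *)
Definition seed n (t : T) : T := f (iter n g t).

Lemma measurable_seed n : measurable_fun setT (seed n).
Proof.
apply: measurableT_comp => //.
by elim: n => [|n ih]; [exact: measurable_id|exact: measurableT_comp].
Qed.

Lemma measurable_preimage_seed n A : measurable A -> measurable (seed n @^-1` A).
Proof. by move=> mA; rewrite -[X in measurable X]setTI; exact: measurable_seed. Qed.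

Lemma measurable_forall_seed n (A : nat -> set T) : (forall i, measurable (A i)) ->
  measurable [set t | forall i, (i < n)%N -> A i (seed i t)].
Proof.
move=> mA; rewrite (_ : mkset _ = \bigcap_(i < n) (seed i @^-1` A i))//.
by apply: bigcap_measurableType => i _; exact: measurable_preimage_seed.
Qed.

Lemma seeds_independent n (A : nat -> set T) : (forall i, measurable (A i)) ->
  P [set t | forall i, (i < n)%N -> A i (seed i t)] = (\prod_(i < n) P (A i))%E.
Proof.
elim: n A => [|n ih] A mA.
  by rewrite big_ord0 (_ : mkset _ = setT) ?probability_setT//; apply/seteqP; split.
rewrite big_ord_recl /= -(ih (fun i => A i.+1))//.
rewrite -fgP//; last exact: (@measurable_forall_seed n (fun i => A i.+1)).
congr (P _); apply/seteqP; split=> t /=.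
  move=> h; split=> [|i lti]; first exact: (h 0%N).
  by have := h i.+1 lti; rewrite /seed iterSr.
move=> [h0 h] [|i] lti; first exact: h0.
by rewrite /seed iterSr; exact: h.
Qed.

(** The probability that a Poisson variable of parameter 1 is less than n. *)
Definition poisson1_cdf n : R := expR (-1) * series (exp_coeff 1) n.

Lemma poisson1_cdf0 : poisson1_cdf 0 = 0.
Proof. by rewrite /poisson1_cdf /series /= big_geq// mulr0. Qed.

Lemma poisson1_cdfS n : poisson1_cdf n.+1 = poisson1_cdf n + expR (-1) / n`!%:R.
Proof.
rewrite /poisson1_cdf /series /= big_nat_recr//= mulrDr; congr (_ + _ * _).
by rewrite /exp_coeff /= expr1n mul1r.
Qed.

Lemma poisson1_cdf_le n m : (n <= m)%N -> poisson1_cdf n <= poisson1_cdf m.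
Proof.
move=> /subnK <-; elim: (m - n)%N => // k /le_trans; apply.
by rewrite addSn poisson1_cdfS lerDl divr_ge0 ?expR_ge0.
Qed.

Lemma cvg_poisson1_cdf : poisson1_cdf n @[n --> \oo] --> (1 : R).
Proof.
rewrite -[X in _ --> X](mulVf (lt0r_neq0 (expR_gt0 1))) -expRN.
by apply: cvgMr; exact: is_cvg_series_exp_coeff.
Qed.

Lemma poisson1_cdf_ge x : x < 1 -> exists n, x < poisson1_cdf n.
Proof.
move=> x1; have [n _ h] := cvgr_gt _ cvg_poisson1_cdf _ x1.
by exists n; exact: (h n (leqnn n)).
Qed.

Lemma poisson1_cdf_count x : 0 <= x < 1 ->
  exists n, poisson1_cdf n <= x < poisson1_cdf n.+1.
Proof.
move=> /andP[x0 x1]; have ex := poisson1_cdf_ge x1.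
case: (ex_minnP ex) => [[|n]]; first by rewrite poisson1_cdf0 ltNge x0.
move=> xn /(_ n) h; exists n; rewrite xn andbT leNgt; apply/negP => /h.
by rewrite ltnn.
Qed.

Section cell.
Context d' (E : measurableType d') (X : T -> E) (mX : measurable_fun setT X).

(** Seed 0 decides the number of points by inversion of the distribution
    function: the j-th candidate is present exactly when the Poisson number
    exceeds j. Seed j + 1 places that candidate. *)
Definition cell_points (t : T) : set E :=
  [set X (seed j.+1 t) | j in [set j | poisson1_cdf j.+1 <= u (seed 0 t)]].

Definition cell_void (S : set E) : set T := [set t | forall x, cell_points t x -> ~ S x].

Let count_is n : set T := u @^-1` `[poisson1_cdf n, poisson1_cdf n.+1[.

Let mcount_is n : measurable (count_is n).
Proof. by rewrite -[X in measurable X]setTI; exact: mu. Qed.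

Let P_count_is n : P (count_is n) = (expR (-1) / n`!%:R)%:E.
Proof.
rewrite uP// /uniform_measure /mrestr (_ : _ `&` _ = `[poisson1_cdf n, poisson1_cdf n.+1[%classic).
  rewrite lebesgue_measure_itv /= lte_fin poisson1_cdfS ltrDl.
  rewrite divr_gt0 ?expR_gt0// ?ltr0n ?fact_gt0//.
  by rewrite -EFinB addrAC subrr add0r.
apply/seteqP; split=> x /=; rewrite !in_itv /=; first by move=> [].
move=> /andP[h1 h2]; split; first by rewrite h1 h2.
apply/andP; split; first by apply: le_trans h1; rewrite -poisson1_cdf0 poisson1_cdf_le.
apply: (lt_le_trans h2); rewrite -(cvg_lim _ cvg_poisson1_cdf)//.
apply: (@nondecreasing_cvgn_le R poisson1_cdf) => [k m km|].
  exact: poisson1_cdf_le.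
by apply/cvg_ex; exists 1; exact: cvg_poisson1_cdf.
Qed.

Variables (S : set E) (mS : measurable S).

Let avoid n : set T := [set t | forall i, (i < n.+1)%N ->
  (if i is 0%N then count_is n else ~` (X @^-1` S)) (seed i t)].

Let mavoid0 n i : measurable (if i is 0%N then count_is n else ~` (X @^-1` S)).
Proof.
case: i => [|_]; first exact: mcount_is.
by apply: measurableC; rewrite -[Y in measurable Y]setTI; exact: mX.
Qed.

Let cell_voidE : cell_void S = \bigcup_n avoid n.
Proof.
apply/seteqP; split=> t.
  move=> void; have [n /andP[h1 h2]] := poisson1_cdf_count (u01 (seed 0 t)).
  exists n => // -[|i] /= lti; first by rewrite /count_is /= in_itv /= h1 h2.
  apply: void; exists i => //=; apply: le_trans h1; exact: poisson1_cdf_le.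
move=> [n _ h] _ [j /= hj <-] /=; apply: (h j.+1).
have := h 0%N (ltn0Sn _); rewrite /count_is /= in_itv /= => /andP[_ un].
rewrite ltnS ltnNge; apply/negP => nj.
have nj' : (n.+1 <= j.+1)%N by rewrite ltnS.
by have := lt_le_trans un (le_trans (poisson1_cdf_le nj') hj); rewrite ltxx.
Qed.

Lemma measurable_cell_void : measurable (cell_void S).
Proof.
rewrite cell_voidE; apply: bigcupT_measurable => n.
exact: (@measurable_forall_seed n.+1 (fun i => if i is 0%N then count_is n else ~` (X @^-1` S))).
Qed.

(** Conditioning on the number n of points gives the sum of e^-1 / n! * (1 -
    p)^n, which is e^-1 * e^(1 - p) = e^-p where p is the chance that one
    point falls in S. *)
Lemma probability_cell_void : P (cell_void S) = (expR (- fine (P (X @^-1` S))))%:E.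
Proof.
set p := fine _.
have mXS : measurable (X @^-1` S) by rewrite -[Y in measurable Y]setTI; exact: mX.
have PXS : P (X @^-1` S) = p%:E by rewrite fineK// fin_num_measure.
have p01 : 0 <= p <= 1.
  by rewrite -!lee_fin -PXS measure_ge0 probability_le1.
have mav n : measurable (avoid n).
  exact: (@measurable_forall_seed n.+1 (fun i => if i is 0%N then count_is n else ~` (X @^-1` S))).
have Pav n : P (avoid n) = (expR (-1) * exp_coeff (1 - p) n)%:E.
  rewrite /avoid (@seeds_independent n.+1 (fun i => if i is 0%N then count_is n else ~` (X @^-1` S)))//.
  rewrite big_ord_recl /= P_count_is.
  rewrite (eq_bigr (fun=> (1 - p)%:E)); last first.
    by move=> i _ /=; rewrite probability_setC// PXS -EFinB.
  rewrite prodEFin -EFinM big_const_ord iter_mulr_1 /exp_coeff /=; congr EFin; ring.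
rewrite cell_voidE measure_bigcup//; last first.
  move=> i j _ _ [t [/= /(_ 0%N (ltn0Sn _)) hi /(_ 0%N (ltn0Sn _)) hj]].
  move: hi hj; rewrite /count_is /= !in_itv /= => /andP[a1 a2] /andP[b1 b2].
  apply/eqP; rewrite eqn_leq; apply/andP; split; rewrite leqNgt; apply/negP => h.
    by have := lt_le_trans b2 (le_trans (poisson1_cdf_le h) a1); rewrite ltxx.
  by have := lt_le_trans a2 (le_trans (poisson1_cdf_le h) b1); rewrite ltxx.
rewrite (eq_eseriesr (fun n _ => Pav n)).
apply/cvg_lim => //.
rewrite (_ : (fun n => _) = (fun n => (expR (-1) * series (exp_coeff (1 - p)) n)%:E)); last first.
  apply/funext => n; rewrite sumEFin; congr EFin.
  by rewrite /series /= mulr_sumr; apply: congr_big => // i; rewrite in_setT.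
suff h : expR (-1) * series (exp_coeff (1 - p)) n @[n --> \oo] --> expR (- p).
  by apply/fine_cvgP; split; [exact: nearW|exact: h].
rewrite [X in _ --> X](_ : _ = expR (-1) * expR (1 - p)); last first.
  by rewrite -expRD; congr expR; ring.
apply: cvgMr; exact: is_cvg_series_exp_coeff.
Qed.

End cell.
End poisson.

(** * The Poisson process in countably many cells *)

Section poisson_process.
Context d (T : measurableType d) (R : realType) (P : probability T R).
Variables (f g : T -> T) (u : T -> R).
Hypotheses (mf : measurable_fun setT f) (mg : measurable_fun setT g).
Hypothesis fgP : forall A B, measurable A -> measurable B ->
  (P (f @^-1` A `&` g @^-1` B) = P A * P B)%E.
Hypotheses (mu : measurable_fun setT u) (u01 : forall t, 0 <= u t < 1).
Hypothesis uP : forall A : set R, measurable A -> P (u @^-1` A) = uniform_measure A.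
Context d' (E : measurableType d') (I : countType) (X : I -> T -> E).
Hypothesis mX : forall k, measurable_fun setT (X k).

Definition poisson_points (t : T) : set E :=
  \bigcup_k cell_points f g u (X k) (seed f g (pickle k) t).

Definition poisson_void (S : set E) : set T :=
  [set t | forall x, poisson_points t x -> ~ S x].

Let void_at S n : set T :=
  if pickle_inv n is Some k then cell_void f g u (X k) S else setT.

Let mvoid_at S n : measurable S -> measurable (void_at S n).
Proof.
by move=> mS; rewrite /void_at; case: pickle_inv => // k; exact: measurable_cell_void.
Qed.

Let poisson_voidE S : poisson_void S =
  \bigcap_n [set t | forall i, (i < n)%N -> void_at S i (seed f g i t)].
Proof.
apply/seteqP; split=> t /=.
  move=> h n _ i _; rewrite /void_at.
  case E1 : (pickle_inv i) => [k|//] x xk Sx; apply: (h x) => //.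
  exists k => //; suff <- : i = pickle k by [].
  by have := @pickle_invK I i; rewrite /oapp E1.
move=> h x [k _ xk]; have := h (pickle k).+1 Logic.I (pickle k) (ltnSn _).
by rewrite /void_at pickleK_inv; exact.
Qed.

Lemma measurable_poisson_void S : measurable S -> measurable (poisson_void S).
Proof.
move=> mS; rewrite poisson_voidE; apply: bigcapT_measurable => n.
by apply: (@measurable_forall_seed _ _ f g mf mg n (void_at S)) => i; exact: mvoid_at.
Qed.

Variables (nu : {measure set E -> \bar R}) (cell : I -> set E).
Hypothesis mcell : forall k, measurable (cell k).
Hypothesis tcell : trivIset setT cell.
Hypothesis Xnu : forall k S, measurable S -> P (X k @^-1` S) = nu (S `&` cell k).

(** The events that the single cells avoid S are independent, and the
    exponents add up by countable additivity of nu over the cells. These void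
    probabilities are all that is needed of the Poisson process with intensity
    nu. *)
Lemma probability_poisson_void S : measurable S -> S `<=` \bigcup_k cell k ->
  (nu S < +oo)%E -> P (poisson_void S) = (expR (- fine (nu S)))%:E.
Proof.
move=> mS Scell nuS.
pose C n := if pickle_inv n is Some k then S `&` cell k else set0.
have mC n : measurable (C n).
  by rewrite /C; case: pickle_inv => // k; exact: measurableI.
have SC : S = \bigcup_n C n.
  apply/seteqP; split=> x.
    move=> Sx; have [k _ kx] := Scell _ Sx.
    by exists (pickle k) => //; rewrite /C pickleK_inv.
  by move=> [n _]; rewrite /C; case: pickle_inv => // k [].
have tC : trivIset setT C.
  move=> i j _ _ [x []]; rewrite /C.
  case Ei : (pickle_inv i) => [k|//]; case Ej : (pickle_inv j) => [l|//].
  move=> [_ kx] [_ lx]; have kl : k = l by apply: tcell => //; exists x.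
  have := @pickle_invK I i; have := @pickle_invK I j.
  by rewrite /oapp Ei Ej kl => <- <-.
have nuC n : nu (C n) \is a fin_num.
  rewrite ge0_fin_numE//; apply: le_lt_trans nuS; apply: le_measure; rewrite ?inE//.
  by rewrite SC; exact: bigcup_sup.
have Pvoid n : P (void_at S n) = (expR (- fine (nu (C n))))%:E.
  rewrite /void_at /C; case: pickle_inv => [k|]; last first.
    by rewrite measure0 /= oppr0 expR0 probability_setT.
  rewrite (probability_cell_void mf mg fgP mu u01 uP (mX k) mS).
  by rewrite Xnu.
have sumC : (fun n => \sum_(i < n) fine (nu (C i))) @ \oo --> fine (nu S).
  have : (\sum_(0 <= i < n) nu (C i))%E @[n --> \oo] --> nu S.
    by rewrite [in X in _ --> X]SC; apply: measure_semi_sigma_additive => //; rewrite -SC.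
  rewrite -[X in _ --> X](@fineK _ (nu S)) ?ge0_fin_numE// => /fine_cvgP[_].
  apply: cvg_trans; apply: near_eq_cvg; near=> n => /=.
  by rewrite big_mkord sum_fine.
have V n : P [set t | forall i, (i < n)%N -> void_at S i (seed f g i t)] =
   (expR (- \sum_(i < n) fine (nu (C i))))%:E.
  rewrite (@seeds_independent _ _ _ P f g mf mg fgP n (void_at S)); last first.
    by move=> i; exact: mvoid_at.
  rewrite (eq_bigr (fun i : 'I_n => (expR (- fine (nu (C i))))%:E)) => [|i _]; last exact: Pvoid.
  by rewrite prodEFin -expR_sum sumrN.
have mV n : measurable [set t | forall i, (i < n)%N -> void_at S i (seed f g i t)].
  by apply: (@measurable_forall_seed _ _ f g mf mg n (void_at S)) => i; exact: mvoid_at.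
rewrite poisson_voidE; apply: (cvg_unique _ (F := P [set t | forall i, (i < n)%N -> void_at S i (seed f g i t)] @[n --> \oo])) => //.
  apply: nonincreasing_cvg_mu => //.
  - by rewrite [X in (X < _)%E]V ltry.
  - exact: bigcapT_measurable.
  - move=> n m nm; apply/subsetPset => t /= h i ni; apply: h.
    exact: leq_trans nm.
rewrite (_ : (fun n => _) = (fun n => (expR (- \sum_(i < n) fine (nu (C i))))%:E)); last first.
  by apply/funext => n; exact: V.
apply/fine_cvgP; split; first exact: nearW.
apply: (@continuous_cvg _ _ _ _ _ _ (fun x => expR (- x)) (fine (nu S)) _ sumC).
apply: continuous_comp; first exact: opp_continuous.
exact: continuous_expR.
Unshelve. all: by end_near. Qed.

(** The Poisson number is finite for every sample and not only almost surely,
    because the uniform variable stays strictly below 1. *)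
Lemma finite_cell_points k t : finite_set (cell_points f g u (X k) t).
Proof.
apply: finite_image.
have /andP[_ u1] := u01 (seed f g 0 t).
have [n un] := @poisson1_cdf_ge R _ u1.
apply: (@sub_finite_set _ _ `I_n) => [j /= hj|]; last exact: finite_II.
rewrite ltnNge; apply/negP => nj.
have nj' : (n <= j.+1)%N by exact: leqW.
by have := lt_le_trans un (le_trans (poisson1_cdf_le R nj') hj); rewrite ltxx.
Qed.
End poisson_process.

(** * Lebesgue measure on tuples *)

Section sigma_finite.
Context d (T : measurableType d) (R : realType).
Variables (m : {measure set T -> \bar R}) (ms : sigma_finite setT m).

(** A copy of m that carries the sigma-finite structure, which the product of
    measures requires. *)
Definition sigma_finite_copy of sigma_finite setT m : set T -> \bar R := m.
HB.instance Definition _ := Measure.copy (sigma_finite_copy ms) m.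
HB.instance Definition _ := Measure_isSigmaFinite.Build _ _ _ (sigma_finite_copy ms) ms.

Lemma sigma_finite_measure_exists :
  exists m' : {sigma_finite_measure set T -> \bar R}, forall A, m' A = m A.
Proof. by exists (sigma_finite_copy ms). Qed.
End sigma_finite.

Section tuple_measure.
Context {R : realType}.
Local Notation leb := (@lebesgue_measure R).

Definition tbox n (A : 'I_n -> set R) : set (n.-tuple R) :=
  [set x | forall i, A i (tnth x i)].

Definition tboxes n : set_system (n.-tuple R) :=
  [set B | exists2 A : 'I_n -> set R, (forall i, measurable (A i)) & B = tbox A].

Lemma measurable_tbox n (A : 'I_n -> set R) : (forall i, measurable (A i)) ->
  measurable (tbox A).
Proof.
move=> mA; rewrite (_ : tbox A = \bigcap_(i in [set: 'I_n]) ((fun x => tnth x i) @^-1` A i)).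
  apply: fin_bigcap_measurable => // i _.
  by rewrite -[X in measurable X]setTI; exact: measurable_tnth.
by apply/seteqP; split=> x /= h i; [move=> _; exact: h|exact: h].
Qed.

Lemma tboxI n (A B : 'I_n -> set R) : tbox A `&` tbox B = tbox (fun i => A i `&` B i).
Proof.
by apply/seteqP; split=> x /= => [[hA hB] i|h]; split => // i; have [] := h i.
Qed.

Lemma setI_closed_tboxes n : setI_closed (@tboxes n).
Proof.
move=> _ _ [A mA ->] [B mB ->]; rewrite tboxI.
by exists (fun i => A i `&` B i) => // i; exact: measurableI.
Qed.

Lemma measurable_tboxesE n : @measurable _ (n.-tuple R) = <<s @tboxes n >>.
Proof.
apply/seteqP; split; last first.
  apply: smallest_sub; first exact: sigma_algebra_measurable.
  by move=> _ [A mA ->]; exact: measurable_tbox.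
apply: smallest_sub; first exact: smallest_sigma_algebra.
rewrite -bigcup_seq; apply: bigcup_sub => i _ _ [B mB <-]; rewrite setTI.
apply: sub_sigma_algebra.
exists (fun j => if j == i then B else setT) => [j|]; first by case: ifP.
apply/seteqP; split=> x /= h; first by move=> j; case: eqP => // ->.
by have := h i; rewrite eqxx.
Qed.

Lemma prode_lty n (F : 'I_n -> R) : ((\prod_(i < n) (F i)%:E)%E < +oo)%E.
Proof. by rewrite prodEFin ltry. Qed.

Definition cube n (k : nat) : set (n.-tuple R) :=
  tbox (fun=> `[- k%:R, k%:R]%classic).

Arguments cube n k : clear implicits.

Lemma bigcup_cube n : \bigcup_k cube n k = setT.
Proof.
apply/seteqP; split=> // x _.
exists (\max_(i < n) (Num.truncn `|tnth x i|).+1)%N => // i.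
rewrite /= in_itv /= -ler_norml.
apply: (le_trans (ltW (truncnS_gt _))).
by rewrite ler_nat; exact: (leq_bigmax i).
Qed.

Lemma measurable_cube n k : measurable (cube n k).
Proof. exact: measurable_tbox. Qed.

Lemma tuple_measure_unique n (m1 m2 : {measure set (n.-tuple R) -> \bar R}) :
  (forall A, (forall i, measurable (A i)) -> m1 (tbox A) = m2 (tbox A)) ->
  (forall k, (m1 (cube n k) < +oo)%E) ->
  forall S, measurable S -> m1 S = m2 S.
Proof.
move=> m12 m1oo S mS.
apply: (@measure_unique _ R (n.-tuple R) (@tboxes n) (cube n)
  (measurable_tboxesE n) (@setI_closed_tboxes n) _ (bigcup_cube n) m1 m2 _ _ S mS) => //.
- by move=> k; exists (fun=> `[- k%:R, k%:R]%classic).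
- by move=> _ [A mA ->]; exact: m12.
Qed.

Lemma tuple_measure_cube_lty n (m : {measure set (n.-tuple R) -> \bar R}) k :
  (forall A, (forall i, measurable (A i)) -> m (tbox A) = (\prod_(i < n) leb (A i))%E) ->
  (m (cube n k) < +oo)%E.
Proof.
move=> mE; rewrite mE// (eq_bigr (fun=> (k%:R - - k%:R)%:E)) ?prode_lty// => i _.
rewrite lebesgue_measure_itv /= lte_fin; case: ifPn => //.
rewrite -leNgt => h; congr EFin; have : 0 <= k%:R :> R by []; lra.
Qed.

(** Induction on n: the product of the line with the measure on n-tuples is
    transported along cons. *)
Lemma lebesgue_tuple_exists n :
  exists m : {sigma_finite_measure set (n.-tuple R) -> \bar R},
    forall A, (forall i, measurable (A i)) -> m (tbox A) = (\prod_(i < n) leb (A i))%E.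
Proof.
have sf k (m : {measure set (k.-tuple R) -> \bar R}) :
    (forall A, (forall i, measurable (A i)) -> m (tbox A) = (\prod_(i < k) leb (A i))%E) ->
    sigma_finite setT m.
  move=> mE; exists (cube k) => [|l]; first by rewrite bigcup_cube.
  by split; [exact: measurable_cube|exact: tuple_measure_cube_lty].
suff [m mE] : exists m : {measure set (n.-tuple R) -> \bar R},
    forall A, (forall i, measurable (A i)) -> m (tbox A) = (\prod_(i < n) leb (A i))%E.
  have [m' m'E] := sigma_finite_measure_exists (sf _ _ mE).
  by exists m' => A mA; rewrite m'E; exact: mE.
elim: n => [|n [m mE]].
  exists (@dirac _ (0.-tuple R) [tuple] R) => A _.
  rewrite big_ord0 /= /dirac indicE mem_set//.
  by move=> -[].
have [m' m'E] := sigma_finite_measure_exists (sf _ _ mE).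
have mcons : measurable_fun setT (fun xt : measurableTypeR R * n.-tuple R =>
    [the n.+1.-tuple R of xt.1 :: xt.2]).
  exact: (@measurable_cons _ _ _ _ fst n snd).
have [m2 m2E] := pushforward_measure_exists (leb \x m')%E mcons.
exists m2 => A mA; rewrite m2E big_ord_recl.
rewrite (_ : _ @^-1` _ = A ord0 `*` tbox (fun i => A (lift ord0 i))).
  rewrite [LHS]product_measure1E//; last by apply: measurable_tbox => i.
    by congr (_ * _)%E; rewrite [LHS]m'E mE.
  exact: mA.
apply/seteqP; split=> -[x t] /=.
  by move=> h; split=> [|i]; [exact: (h ord0)|have := h (lift ord0 i); rewrite tnthS].
move=> [h0 h] i; case: (unliftP ord0 i) => [j ->|->]; last exact: h0.
by rewrite tnthS; exact: h.
Qed.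

Definition tshift n (z : 'I_n -> R) (x : n.-tuple R) : n.-tuple R :=
  [tuple tnth x i + z i | i < n].

Lemma measurable_tshift n (z : 'I_n -> R) : measurable_fun setT (tshift z).
Proof.
apply/measurable_fun_tnthP => i.
rewrite (_ : _ \o _ = (fun x : n.-tuple R => tnth x i + z i)).
  by apply: measurable_funD => //; exact: measurable_tnth.
by apply/funext => x /=; rewrite tnth_mktuple.
Qed.

Lemma lebesgue_measure_shift (z : R) (A : set R) : measurable A ->
  leb ((fun x => x + z) @^-1` A) = leb A.
Proof.
move=> mA; rewrite (lebesgue_measure_affine z ltr01 mA) mul1e.
by congr lebesgue_measure; apply/seteqP; split=> x /=; rewrite mul1r.
Qed.

Lemma measurable_shift (z : R) (A : set R) : measurable A ->
  measurable ((fun x => x + z) @^-1` A).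
Proof.
move=> mA; rewrite -[X in measurable X]setTI.
by apply: (_ : measurable_fun setT _) => //; exact: measurable_funD.
Qed.

Section lebesgue_tuple.
Variables (n : nat) (m : {measure set (n.-tuple R) -> \bar R}).
Hypothesis mE : forall A, (forall i, measurable (A i)) ->
  m (tbox A) = (\prod_(i < n) leb (A i))%E.

(** A translated box has the volume of the box, and the boxes determine the
    measure. *)
Lemma tuple_measure_shift (z : 'I_n -> R) S : measurable S ->
  m (tshift z @^-1` S) = m S.
Proof.
move=> mS; have [m' m'E] := pushforward_measure_exists m (measurable_tshift z).
rewrite -m'E; apply/esym/tuple_measure_unique => //; last by move=> k; exact: tuple_measure_cube_lty.
move=> A mA; apply/esym; rewrite [LHS]m'E.
rewrite (_ : _ @^-1` _ = tbox (fun i => (fun x => x + z i) @^-1` A i)).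
  rewrite !mE// => [|i]; last exact: measurable_shift.
  by apply: eq_bigr => i _; exact: lebesgue_measure_shift.
by apply/seteqP; split=> x /= h i; have := h i; rewrite /= tnth_mktuple.
Qed.
End lebesgue_tuple.
End tuple_measure.

(** * Environments as lower envelopes of wells *)

Section row_norm.
Context {R : realType} {d : nat}.
Implicit Types x y : 'rV[R]_d.

Lemma rV_norm_leP x (e : R) : 0 <= e ->
  (`|x| <= e) <-> (forall j, `|x ord0 j| <= e).
Proof.
move=> e0; have -> : `|x| = mx_norm x by [].
rewrite mx_normrE; split=> [h j|h].
  apply: le_trans h.
  exact: (@le_bigmax _ R _ 0 (fun ij : 'I_1 * 'I_d => `|x ij.1 ij.2|) (ord0, j)).
by apply: bigmax_le => // -[i j] _ /=; rewrite (ord1 i).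
Qed.
End row_norm.

Section environment.
Context {R : realType} {d : nat} (lam r : {posnum R}).
Implicit Types x y z : 'rV[R]_d.

(** The last clause says that low values come in plateaus: every value is
    attained up to a larger one on a full cube of radius r nearby. Since the
    sub-level sets thus contain large cubes, a small value of the field at one
    point already forces a trap. *)
Definition admissible (f : 'rV[R]_d -> R) : Prop :=
  [/\ forall y, 0 < f y <= lam%:num,
      forall y z, f y <= f z + `|y - z| &
      forall z, exists2 x, `|z - x| <= r%:num + lam%:num &
        forall y, `|y - x| <= r%:num -> f y <= f z].

Lemma admissible_cst : admissible (fun=> lam%:num).
Proof.
split=> [y|y z|z]; first by rewrite lexx andbT.
  by rewrite lerDl.
by exists z => //; rewrite subrr normr0 addr_ge0.
Qed.

Definition env : Type := {f : 'rV[R]_d -> R | admissible f}.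
HB.instance Definition _ := gen_eqMixin env.
HB.instance Definition _ := gen_choiceMixin env.
HB.instance Definition _ := isPointed.Build env (exist _ _ admissible_cst).

Definition levels (F : seq ('rV[R]_d * R)) : Prop :=
  forall p, p \in F -> 0 < p.2 < lam%:num.

(** The finite-dimensional events, given by finitely many pairs (point,
    level). *)
Definition exceeds (F : seq ('rV[R]_d * R)) : set env :=
  [set w | forall p, p \in F -> p.2 < sval w p.1].

Definition env_cylinders : set_system env :=
  [set B | exists2 F, levels F & B = exceeds F].

Definition Env : Type := g_sigma_algebraType env_cylinders.
HB.instance Definition _ := Measurable.on Env.

End environment.

Lemma seq_argmin (R : realDomainType) (T : eqType) (w : T -> R) (s : seq T) :
  s != [::] -> exists2 x, x \in s & forall y, y \in s -> w x <= w y.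
Proof.
elim: s => // a s ih _; have [->|s0] := eqVneq s [::].
  by exists a; rewrite ?mem_head// => y; rewrite inE => /eqP ->.
have [x xs xm] := ih s0; have [ax|ax] := leP (w a) (w x).
  exists a; first exact: mem_head.
  by move=> y; rewrite inE => /orP[/eqP -> //|/xm]; exact: le_trans.
exists x; first by rewrite inE xs orbT.
by move=> y; rewrite inE => /orP[/eqP ->|/xm //]; exact: ltW.
Qed.

Section wells.
Context {R : realType} {d : nat} (lam r : {posnum R}) (q : R).
Hypothesis q0 : 0 < q.
Implicit Types (x : d.+1.-tuple R) (y z : 'rV[R]_d) (pts : set (d.+1.-tuple R)).

(** Coordinate 0 of x is a mark, uniform in `[0, 1[; the depth then has
    distribution function a |-> a^q on `[0, 1]. *)
Definition depth x : R := (1 - tnth x ord0) `^ q^-1.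

Definition place x : 'rV[R]_d := \row_j tnth x (lift ord0 j).

Definition well x y : R := Num.max (depth x) (`|y - place x| - r%:num).

Definition locally_finite pts : Prop :=
  (forall x, pts x -> 0 <= tnth x ord0 < 1) /\
  forall y rho, finite_set (pts `&` [set x | `|y - place x| <= rho]).

(** The infimum of lam and of the wells, in a form that records that it is
    attained. *)
Definition lower_value pts y (v : R) : Prop :=
  [/\ v <= lam%:num, forall x, pts x -> v <= well x y &
      v = lam%:num \/ exists2 x, pts x & v = well x y].

(** Only wells centred within distance r + lam of y can lie below lam at y,
    and there are finitely many of them. *)
Lemma lower_value_exists pts y : locally_finite pts -> exists v, lower_value pts y v.
Proof.
move=> [_ /(_ y (r%:num + lam%:num))] /finite_seqP[s sE].
have wlt x : well x y < lam%:num -> `|y - place x| <= r%:num + lam%:num.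
  by rewrite /well gt_max => /andP[_]; rewrite ltrBlDl => /ltW.
have [h|/existsNP[x0 /not_implyP[px0 /negP]]] := pselect (forall x, pts x -> lam%:num <= well x y).
  by exists lam%:num; split=> //; left.
rewrite -ltNge => x0lt.
have x0s : x0 \in s by have : [set` s] x0 by rewrite -sE; split => //; exact: wlt.
have s0 : s != [::] by apply/eqP => s0; rewrite s0 in x0s.
have [x xs xm] := seq_argmin (well^~ y) s0.
have [px xr] : (pts `&` [set x | `|y - place x| <= r%:num + lam%:num]) x by rewrite sE.
have xlam : well x y < lam%:num by apply: le_lt_trans x0lt; exact: xm.
exists (well x y); split; [exact: ltW| |by right; exists x].
move=> z pz; have [lz|/wlt zs] := leP lam%:num (well z y).
  by apply: le_trans lz; exact: ltW.
apply: xm; have : (pts `&` [set x | `|y - place x| <= r%:num + lam%:num]) z by split.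
by rewrite sE.
Qed.

Definition field pts y : R := xget 0 [set v | lower_value pts y v].

Lemma fieldP pts y : locally_finite pts -> lower_value pts y (field pts y).
Proof. by move=> /(lower_value_exists y)/(xgetPex 0). Qed.

Lemma depth_gt0 x : tnth x ord0 < 1 -> 0 < depth x.
Proof. by move=> h; rewrite powR_gt0 // subr_gt0. Qed.

Lemma depth_le x a : 0 < a -> tnth x ord0 < 1 ->
  (depth x <= a) = (1 - a `^ q <= tnth x ord0).
Proof.
move=> a0 x1; rewrite lerBlDl -lerBlDr /depth.
have : 0 <= 1 - tnth x ord0 by rewrite subr_ge0 ltW.
set t := 1 - _ => t0.
have qV0 : 0 <= q^-1 by rewrite invr_ge0 ltW.
apply/idP/idP => h.
  have -> : t = (t `^ q^-1) `^ q by rewrite -powRrM mulVf ?powRr1// lt0r_neq0.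
  by apply: (ge0_ler_powR (ltW q0)) => //; rewrite nnegrE ?powR_ge0// ltW.
have -> : a = (a `^ q) `^ q^-1 by rewrite -powRrM mulfV ?powRr1 ?lt0r_neq0// ltW.
by apply: (ge0_ler_powR qV0) => //; rewrite nnegrE ?powR_ge0.
Qed.

Lemma well_le x y a :
  (well x y <= a) = (depth x <= a) && (`|y - place x| <= r%:num + a).
Proof. by rewrite /well ge_max lerBlDl. Qed.

(** A lower envelope of 1-Lipschitz wells is 1-Lipschitz. If the value at z is
    attained by the well of x, then on the cube of radius r around the place
    of x that well equals its depth, which is at most the value at z. *)
Lemma admissible_field pts : locally_finite pts -> admissible lam r (field pts).
Proof.
move=> lf; split=> [y|y z|z].
- have [vl _ vE] := fieldP y lf; rewrite vl andbT.
  case: vE => [->//|[x px ->]]; rewrite /well lt_max depth_gt0//.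
  by have /andP[] := lf.1 x px.
- have [yl yx _] := fieldP y lf; have [zl zx zE] := fieldP z lf.
  case: zE => [->|[x px ->]]; first by apply: (le_trans yl); rewrite lerDl.
  apply: (le_trans (yx x px)); rewrite well_le; apply/andP; split.
    by apply: (@le_trans _ _ (well x z)); rewrite ?lerDl// /well le_max lexx.
  have h : `|y - place x| <= `|y - z| + `|z - place x| by exact: ler_distD.
  have : `|z - place x| - r%:num <= well x z by rewrite /well le_max lexx orbT.
  by move: h; set s := `|y - z|; set t := `|z - _|; set v := well _ _; lra.
- have [zl zx zE] := fieldP z lf.
  case: zE => [->|[x px zE]].
    exists z => [|y _]; first by rewrite subrr normr0 addr_ge0.
    by have [] := fieldP y lf.
  exists (place x).
    by have := zl; rewrite zE well_le => /andP[].
  move=> y yx; have [_ /(_ x px) yw _] := fieldP y lf.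
  apply: (le_trans yw); rewrite zE well_le; apply/andP; split.
    by rewrite /well le_max lexx.
  apply: (le_trans yx); rewrite lerDl /well le_max powR_ge0//.
Qed.

(** The points whose well is at most p.2 at p.1: the mark lies in the last
    p.2^q of the unit interval and the place lies in a cube. Being a box, the
    set has an explicit volume. *)
Definition well_box (p : 'rV[R]_d * R) (i : 'I_d.+1) : set R :=
  if unlift ord0 i is Some j
  then `[p.1 ord0 j - (r%:num + p.2), p.1 ord0 j + (r%:num + p.2)]
  else `[1 - p.2 `^ q, 1[.

Definition well_set p : set (d.+1.-tuple R) := tbox (well_box p).

Definition well_sets (F : seq ('rV[R]_d * R)) : set (d.+1.-tuple R) :=
  \bigcup_(p in [set` F]) well_set p.

Lemma measurable_well_box p i : measurable (well_box p i).
Proof. by rewrite /well_box; case: unlift. Qed.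

Lemma measurable_well_set p : measurable (well_set p).
Proof. by apply: measurable_tbox => i; exact: measurable_well_box. Qed.

Lemma measurable_well_sets F : measurable (well_sets F).
Proof. by apply: fin_bigcup_measurable => // p _; exact: measurable_well_set. Qed.

Lemma well_setP p x : 0 < p.2 -> 0 <= tnth x ord0 < 1 ->
  well_set p x <-> well x p.1 <= p.2.
Proof.
move=> p0 /andP[x0 x1]; rewrite well_le depth_le//; split.
  move=> h; have := h ord0; rewrite /well_box unlift_none /= in_itv /= => /andP[-> _] /=.
  apply/rV_norm_leP => [|j]; first by rewrite addr_ge0// ltW.
  have := h (lift ord0 j); rewrite /well_box liftK /= in_itv /= !mxE => /andP[h1 h2].
  by rewrite ler_norml; apply/andP; split; lra.
move=> /andP[h1 /rV_norm_leP h2] i; rewrite /well_box.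
case: unliftP => [j ->|->]; rewrite /= in_itv /= ?h1//.
have rp : 0 <= r%:num + p.2 by rewrite addr_ge0// ltW.
have := h2 rp j; rewrite !mxE ler_norml => /andP[h3 h4]; apply/andP; split; lra.
Qed.

(** Being above the level a at y is a void event of the configuration of
    wells. *)
Lemma field_gt pts y a : locally_finite pts -> 0 < a < lam%:num ->
  a < field pts y <-> forall x, pts x -> ~ well_set (y, a) x.
Proof.
move=> lf /andP[a0 alam]; have [vl vx vE] := fieldP y lf; split.
  move=> h x px /(well_setP (p := (y, a)) a0 (lf.1 x px)) /= wa.
  by have := le_lt_trans (le_trans (vx x px) wa) h; rewrite ltxx.
move=> h; case: vE => [->//|[x px ->]]; rewrite ltNge; apply/negP => wa.
by apply: (h x px); apply/(well_setP (p := (y, a)) a0 (lf.1 x px)).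
Qed.

End wells.

(** * The law of the environment *)

Section cells.
Context {R : realType} {d : nat}.

(** Cells are unit cubes with integer corners in the place coordinates, and
    `[0, 1[ in the mark coordinate. *)
Definition offset (k : d.-tuple int) (i : 'I_d.+1) : int :=
  if unlift ord0 i is Some j then tnth k j else 0.

Definition cell (k : d.-tuple int) : set (d.+1.-tuple R) :=
  tbox (fun i => `[(offset k i)%:~R, (offset k i)%:~R + 1[%classic).

Lemma measurable_cell k : measurable (cell k).
Proof. exact: measurable_tbox. Qed.

Lemma trivIset_cell : trivIset setT cell.
Proof.
move=> k l _ _ [x [kx lx]]; apply: eq_from_tnth => j.
have := kx (lift ord0 j); have := lx (lift ord0 j).
rewrite /offset liftK /= !in_itv /=.
rewrite -!intrD1 => h1 h2.
by rewrite -(floor_def h1) -(floor_def h2).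
Qed.

Lemma cell_cover (x : d.+1.-tuple R) : 0 <= tnth x ord0 < 1 -> (\bigcup_k cell k) x.
Proof.
move=> x01; exists [tuple Num.floor (tnth x (lift ord0 j)) | j < d] => // i.
rewrite /offset; case: unliftP => [j ->|->]; rewrite /= in_itv /= ?add0r//.
by rewrite tnth_mktuple floor_le_tmp -intrD1 floorD1_gt.
Qed.

Definition bounded_tuples (M : nat) : set (d.-tuple int) :=
  [set k | forall j, - M%:Z <= tnth k j <= M%:Z].

Lemma finite_bounded_tuples M : finite_set (bounded_tuples M).
Proof.
apply: (@sub_finite_set _ _
  ((fun h : {ffun 'I_d -> 'I_(M.*2.+1)} => [tuple (h j)%:Z - M%:Z | j < d]) @` setT)).
  move=> k /= kM.
  have hk j : (absz (tnth k j + M%:Z)%R < M.*2.+1)%N.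
    by have /andP[h1 h2] := kM j; rewrite -ltz_nat gez0_abs -?lerBlDr ?sub0r//; move: h1 h2; move: (tnth k j : int) => z; lia.
  exists [ffun j => Ordinal (hk j)] => //.
  apply: eq_from_tnth => j; rewrite tnth_mktuple ffunE /=.
  have /andP[h1 h2] := kM j.
  by rewrite gez0_abs ?addrK// -lerBlDr sub0r.
by apply: finite_image; exact: finite_finset.
Qed.
End cells.

Section env_law.
Context {R : realType} {d : nat} (lam r : {posnum R}) (q : R).
Hypotheses (q0 : 0 < q) (lam1 : lam%:num <= 1).
Variables (P : probability coins R) (f g : coins -> coins) (u : coins -> R).
Hypotheses (mf : measurable_fun setT f) (mg : measurable_fun setT g).
Hypothesis fgP : forall A B, measurable A -> measurable B ->
  (P (f @^-1` A `&` g @^-1` B) = P A * P B)%E.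
Hypotheses (mu : measurable_fun setT u) (u01 : forall t, 0 <= u t < 1).
Hypothesis uP : forall A : set R, measurable A -> P (u @^-1` A) = uniform_measure A.
Variable nu : {measure set (d.+1.-tuple R) -> \bar R}.
Hypothesis nuE : forall A, (forall i, measurable (A i)) ->
  nu (tbox A) = (\prod_(i < d.+1) (@lebesgue_measure R) (A i))%E.

Definition cell_point (k : d.-tuple int) (t : coins) : d.+1.-tuple R :=
  [tuple u (seed f g i t) + (offset k i)%:~R | i < d.+1].

Lemma measurable_cell_point k : measurable_fun setT (cell_point k).
Proof.
apply/measurable_fun_tnthP => i.
rewrite (_ : _ \o _ = (fun t => u (seed f g i t) + (offset k i)%:~R)).
  apply: measurable_funD => //; apply: measurableT_comp => //.
  exact: measurable_seed.
by apply/funext => x /=; rewrite tnth_mktuple.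
Qed.

Lemma cell_point_law k S : measurable S ->
  P (cell_point k @^-1` S) = nu (S `&` cell k).
Proof.
move=> mS; have [m1 m1E] := pushforward_measure_exists P (measurable_cell_point k).
pose m2 : {measure set (d.+1.-tuple R) -> \bar R} := mrestr nu (measurable_cell k).
rewrite -m1E; apply: (tuple_measure_unique (m1 := m1) (m2 := m2)) => //; last first.
  move=> l; rewrite [X in (X < _)%E]m1E.
  rewrite (@le_lt_trans _ _ 1%E) ?ltry//; apply: probability_le1.
  rewrite -[X in measurable X]setTI; apply: measurable_cell_point => //.
  exact: measurable_cube.
move=> A mA; apply: (etrans (m1E _)).
pose o i : set R := `[(offset k i)%:~R, (offset k i)%:~R + 1[%classic.
have -> : m2 (tbox A) = (\prod_(i < d.+1) (@lebesgue_measure R) (A i `&` o i))%E.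
  rewrite -nuE => [|i]; first by rewrite -tboxI.
  by apply: measurableI => //; exact: measurable_itv.
pose A' n : set coins :=
  u @^-1` ((fun x => x + (offset k (inord n))%:~R) @^-1` A (inord n)).
have -> : cell_point k @^-1` tbox A =
    [set t | forall i, (i < d.+1)%N -> A' i (seed f g i t)].
  apply/seteqP; split=> t /= h i; last first.
    by have := h i (ltn_ord i); rewrite /A' /= tnth_mktuple inord_val.
  move=> lti; have := h (Ordinal lti); rewrite tnth_mktuple /A' /=.
  by rewrite (_ : inord i = Ordinal lti)//; apply/val_inj; rewrite /= inordK.
have mA' n : measurable (A' n).
  rewrite -[X in measurable X]setTI; apply: mu => //.
  by apply: measurable_shift; exact: mA.
apply: (etrans (seeds_independent mf mg fgP d.+1 mA')).
apply: eq_bigr => i _; rewrite /A' uP ?inord_val//; last exact: measurable_shift.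
rewrite /uniform_measure /mrestr /o -[RHS](lebesgue_measure_shift (offset k i)%:~R); last first.
  exact: measurableI.
congr lebesgue_measure; apply/seteqP; split=> x /=; rewrite !in_itv /=.
  by move=> [Ax /andP[h1 h2]]; split => //; apply/andP; split; lra.
by move=> [Ax /andP[h1 h2]]; split => //; apply/andP; split; lra.
Qed.

Lemma cell_points_cell k t x : cell_points f g u (cell_point k) t x -> cell k x.
Proof.
move=> [j _ <-] i; rewrite tnth_mktuple /= in_itv /=.
have /andP[h1 h2] := u01 (seed f g i (seed f g j.+1 t)).
by apply/andP; split; lra.
Qed.

Definition wells (t : coins) : set (d.+1.-tuple R) := poisson_points f g u cell_point t.

Lemma wells_locally_finite t : locally_finite (wells t).
Proof.
split=> [x [k _ /cell_points_cell/(_ ord0)]|y rho].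
  by rewrite /offset unlift_none /= in_itv /= add0r.
pose M := (Num.truncn (`|y| + `|rho| + 1)).+1.
apply: (@sub_finite_set _ _
  (\bigcup_(k in bounded_tuples M) cell_points f g u (cell_point k) (seed f g (pickle k) t))).
  move=> x [[k _ xk] /= xy]; exists k => // j.
  have := cell_points_cell xk (lift ord0 j); rewrite /offset liftK /= in_itv /= => /andP[h1 h2].
  have := (rV_norm_leP (y - place x) (normr_ge0 rho)).1 (le_trans xy (ler_norm _)) j.
  have := (rV_norm_leP y (normr_ge0 y)).1 (lexx _) j.
  have := truncnS_gt (`|y| + `|rho| + 1); rewrite -/M !mxE !ler_norml => MB.
  move=> /andP[y1 y2] /andP[z1 z2].
  by apply/andP; split; rewrite -(ler_int R) ?mulrNz -pmulrn; lra.
apply: bigcup_finite; first exact: finite_bounded_tuples.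
by move=> k _; exact: finite_cell_points.
Qed.

(** The environment is defined for every sample, since the configuration is
    locally finite and all depths are positive for every sample. *)
Definition env_of (t : coins) : Env (d := d) lam r :=
  exist _ _ (admissible_field lam r q (wells_locally_finite t)).

Lemma env_of_exceeds F : levels lam F -> env_of @^-1` exceeds F =
  poisson_void f g u cell_point (well_sets r q F).
Proof.
move=> lF; apply/seteqP; split=> t.
  move=> h x xt [p pF px].
  have [/(_ (h p pF)) + _] := @field_gt R d lam r q q0 (wells t) p.1 p.2
    (wells_locally_finite t) (lF p pF).
  by move=> /(_ x xt); apply; case: (p) px.
move=> h p pF.
have [_] := @field_gt R d lam r q q0 (wells t) p.1 p.2 (wells_locally_finite t) (lF p pF).
apply => x xt px; apply: (h x xt); exists p => //; by case: (p) px.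
Qed.

Lemma measurable_env_of : measurable_fun setT env_of.
Proof.
apply: (@measurability _ _ _ _ setT env_of (@env_cylinders R d lam r) erefl).
move=> _ [_ [F lF ->] <-]; rewrite setTI env_of_exceeds//.
apply: measurable_poisson_void => //; first exact: measurable_cell_point.
exact: measurable_well_sets.
Qed.

Lemma well_set_lty (p : 'rV[R]_d * R) : (nu (well_set r q p) < +oo)%E.
Proof.
rewrite nuE => [|i]; last exact: measurable_well_box.
have fin i : (@lebesgue_measure R) (well_box r q p i) \is a fin_num.
  rewrite /well_box; case: unlift => [j|]; rewrite lebesgue_measure_itv /=; case: ifP => //.
rewrite (eq_bigr (fun i => (fine ((@lebesgue_measure R) (well_box r q p i)))%:E)) ?prode_lty//.
by move=> i _; rewrite fineK.
Qed.

Lemma well_sets_lty F :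
  (nu (well_sets r q F) < +oo)%E.
Proof.
rewrite /well_sets bigcup_seq; elim: F => [|p F ih]; first by rewrite big_nil measure0.
rewrite big_cons; apply: (le_lt_trans (measureU2 _ _ _)).
- exact: measurable_well_set.
- by rewrite -bigcup_seq; exact: measurable_well_sets.
- by rewrite lte_add_pinfty// well_set_lty.
Qed.

Lemma env_of_law F : levels lam F -> P (env_of @^-1` exceeds F) =
  (expR (- fine (nu (well_sets r q F))))%:E.
Proof.
move=> lF; rewrite env_of_exceeds//.
apply: (probability_poisson_void mf mg fgP mu u01 uP measurable_cell_point
  measurable_cell trivIset_cell cell_point_law).
- exact: measurable_well_sets.
- move=> x [p /(lF p)/andP[p0 plam] px]; apply: cell_cover.
  have := px ord0; rewrite /well_box unlift_none /= in_itv /= => /andP[h ->].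
  rewrite andbT; apply: le_trans h; rewrite subr_ge0.
  apply: (@le_trans _ _ (1 `^ q)); last by rewrite powR1.
  apply: (ge0_ler_powR (ltW q0)); rewrite ?nnegrE ?(ltW p0)//.
  exact: le_trans (ltW plam) lam1.
- exact: well_sets_lty.
Qed.
End env_law.

(** The finite-dimensional laws of the field are the void probabilities of a
    Poisson process, hence are governed by a single volume. Stationarity,
    independence and all estimates below use only this formula. *)
Theorem env_law_exists (R : realType) d (lam r : {posnum R}) (q : R) :
  0 < q -> lam%:num <= 1 ->
  forall nu : {measure set (d.+1.-tuple R) -> \bar R},
  (forall A, (forall i, measurable (A i)) ->
    nu (tbox A) = (\prod_(i < d.+1) (@lebesgue_measure R) (A i))%E) ->
  exists P : probability (Env (d := d) lam r) R, forall F, levels lam F ->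
    P (exceeds F) = (expR (- fine (nu (well_sets r q F))))%:E.
Proof.
move=> q0 lam1 nu nuE; have [P PE] := @coin_measure_exists R.
pose mf := measurable_reindex_coins double.
pose mg := measurable_reindex_coins (succn \o double).
have ind := coin_measure_independent PE.
have uP := coin_measure_uniform PE.
have mu := @measurable_uniform_of_coins R.
have u01 := @uniform_of_coins01 R.
have [m mE] := pushforward_measure_exists P
  (measurable_env_of (d := d) (lam := lam) (r := r) q0 mf mg mu u01).
have m1 : m setT = 1%E by rewrite mE preimage_setT; exact: probability_setT.
have [Q QE] := probability_of_measure m1.
exists Q => F lF; rewrite QE mE.
exact: (env_of_law r q0 lam1 mf mg ind mu u01 uP nuE lF).
Qed.

(** * Shifts and the evaluation field *)

Section enorm.
Context {R : realType} {d : nat}.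
Implicit Types x y : 'rV[R]_d.

Lemma norm_coord_le x j : `|x ord0 j| <= `|x|.
Proof. exact: (rV_norm_leP x (normr_ge0 x)).1. Qed.

Lemma enorm_le x : enorm x <= d%:R * `|x|.
Proof.
have dx0 : 0 <= d%:R * `|x| by rewrite mulr_ge0.
rewrite /enorm -[leRHS]ger0_norm// -sqrtr_sqr ler_sqrt ?sqr_ge0//.
apply: (@le_trans _ _ (\sum_(i < d) `|x| ^+ 2)).
  apply: ler_sum => i _; rewrite -[X in X <= _]real_normK ?num_real//.
  by rewrite lerXn2r ?nnegrE// norm_coord_le.
rewrite sumr_const card_ord exprMn -(mulr_natl (`|x| ^+ 2)).
apply: ler_wpM2r; first exact: sqr_ge0.
by rewrite -natrX ler_nat; case: (d) => // n; rewrite (@leq_pexp2l n.+1 1 2).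
Qed.
End enorm.

Section env_theory.
Context {R : realType} {d : nat} (lam r : {posnum R}).
Local Notation Env := (Env (d := d) lam r).
Implicit Types (w : Env) (y z : 'rV[R]_d) (F : seq ('rV[R]_d * R)).

Definition ellipticity y (w : Env) : R := sval w y.

Lemma admissible_env_shift z (h : 'rV[R]_d -> R) : admissible lam r h ->
  admissible lam r (fun y => h (y + z)).
Proof.
move=> [h0 hL ht]; split=> [y|y y'|y]; first exact: h0.
  by apply: (le_trans (hL _ (y' + z))); rewrite opprD addrACA subrr addr0.
have [x yx hx] := ht (y + z); exists (x - z); first by rewrite opprB addrA.
by move=> y' y'x; apply: hx; rewrite opprB addrA in y'x.
Qed.

Definition env_shift z (w : Env) : Env := exist _ _ (admissible_env_shift z (svalP w)).

Lemma env_eq (w w' : Env) : (forall y, ellipticity y w = ellipticity y w') -> w = w'.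
Proof.
by case: w w' => [h hP] [h' hP'] /= hh'; apply: eq_exist; apply/funext.
Qed.

Lemma ellipticity_shift y z w : ellipticity y (env_shift z w) = ellipticity (y + z) w.
Proof. by []. Qed.

Lemma env_shift0 w : env_shift 0 w = w.
Proof. by apply: env_eq => y; rewrite ellipticity_shift addr0. Qed.

Lemma env_shiftD y z w : env_shift (y + z) w = env_shift y (env_shift z w).
Proof. by apply: env_eq => x; rewrite !ellipticity_shift addrA. Qed.

Lemma env_shift_image z (A : set Env) : env_shift z @` A = env_shift (- z) @^-1` A.
Proof.
apply/seteqP; split=> w /=; first by move=> [w' Aw' <-]; rewrite -env_shiftD addNr env_shift0.
by move=> Aw; exists (env_shift (- z) w) => //; rewrite -env_shiftD addrN env_shift0.
Qed.

Definition translate z F := [seq (p.1 + z, p.2) | p <- F].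

Lemma levels_translate z F : levels lam F -> levels lam (translate z F).
Proof. by move=> lF _ /mapP[p pF ->]; exact: (lF p pF). Qed.

Lemma env_shift_exceeds z F : env_shift z @^-1` exceeds F = exceeds (translate z F).
Proof.
apply/seteqP; split=> w /= h p; first by move=> /mapP[p' pF ->]; exact: (h p' pF).
by move=> pF; apply: (h (p.1 + z, p.2)); apply/mapP; exists p.
Qed.

Lemma levels_cat F F' : levels lam F -> levels lam F' -> levels lam (F ++ F').
Proof. by move=> lF lF' p; rewrite mem_cat => /orP[]; [exact: lF|exact: lF']. Qed.

Lemma exceeds_cat F F' : exceeds F `&` exceeds F' = exceeds (F ++ F') :> set Env.
Proof.
apply/seteqP; split=> w /=.
  by move=> [h h'] p; rewrite mem_cat => /orP[]; [exact: h|exact: h'].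
by move=> h; split=> p pF; apply: h; rewrite mem_cat; apply/orP; [left|right].
Qed.

Lemma env_cylindersT : @env_cylinders R d lam r setT.
Proof. by exists [::] => //; apply/seteqP; split. Qed.

(** Events that look at the field only at points of V. *)
Definition local_cylinders (V : set 'rV[R]_d) : set_system Env :=
  [set B | exists F, [/\ levels lam F, forall p, p \in F -> V p.1 & B = exceeds F]].

Lemma local_cylindersT V : local_cylinders V setT.
Proof. by exists [::]; split => //; apply/seteqP; split. Qed.

Lemma local_cylindersI V : setI_closed (local_cylinders V).
Proof.
move=> _ _ [F [lF VF ->]] [F' [lF' VF' ->]]; rewrite exceeds_cat.
exists (F ++ F'); split => //; first exact: levels_cat.
by move=> p; rewrite mem_cat => /orP[]; [exact: VF|exact: VF'].
Qed.

Lemma local_cylinders_setT : local_cylinders setT = @env_cylinders R d lam r.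
Proof.
apply/seteqP; split=> B; first by move=> [F [lF _ ->]]; exists F.
by move=> [F lF ->]; exists F.
Qed.

Lemma local_cylinders_measurable V : local_cylinders V `<=` @measurable _ Env.
Proof. by move=> _ [F [lF _ ->]]; apply: sub_sigma_algebra; exists F. Qed.

Lemma measurable_ellipticity_local V y : V y ->
  measurable_fun setT (ellipticity y : g_sigma_algebraType (local_cylinders V) -> R).
Proof.
move=> Vy; apply: (measurability _ (RGenOInfty.measurableE R)).
move=> _ [_ [a ->] <-]; rewrite setTI.
have [a0|a0] := leP a 0.
  rewrite (_ : _ @^-1` _ = setT); first exact: measurableT.
  apply/seteqP; split=> // w _; rewrite /= in_itv /= andbT.
  by apply: (le_lt_trans a0); have [/(_ y)/andP[]] := svalP w.
have [la|la] := leP lam%:num a.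
  rewrite (_ : _ @^-1` _ = set0); first exact: measurable0.
  apply/seteqP; split=> // w; rewrite /= in_itv /= andbT => aw.
  have [/(_ y)/andP[_ wl] _ _] := svalP w.
  by have := lt_le_trans aw (le_trans wl la); rewrite ltxx.
apply: sub_sigma_algebra; exists [:: (y, a)]; split.
- by move=> p; rewrite inE => /eqP -> /=; rewrite a0.
- by move=> p; rewrite inE => /eqP ->.
apply/seteqP; split=> w /=; rewrite in_itv /= andbT.
  by move=> h p; rewrite inE => /eqP ->.
by move=> /(_ (y, a)); apply; rewrite inE.
Qed.

Lemma measurable_ellipticity y : measurable_fun setT (ellipticity y).
Proof.
by have := @measurable_ellipticity_local setT y Logic.I; rewrite local_cylinders_setT.
Qed.

Lemma sigma_field_local V : sigma_field ellipticity V `<=` <<s local_cylinders V >>.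
Proof.
apply: smallest_sub; first exact: smallest_sigma_algebra.
apply: bigcup_sub => y Vy _ [B mB <-].
exact: (measurable_ellipticity_local Vy).
Qed.

Lemma measurable_env_shift z : measurable_fun setT (env_shift z).
Proof.
apply: (@measurability _ _ Env Env setT (env_shift z) (@env_cylinders R d lam r) erefl).
move=> _ [_ [F lF ->] <-]; rewrite setTI env_shift_exceeds.
by apply: sub_sigma_algebra; exists (translate z F) => //; exact: levels_translate.
Qed.

Lemma unif_continuous_ellipticity w : unif_continuous (fun y => ellipticity y w).
Proof.
have lip y z : `|ellipticity y w - ellipticity z w| <= `|y - z|.
  have [_ h _] := svalP w; rewrite ler_distl lerBlDr h andbT.
  by have := h z y; rewrite distrC.
move=> U; rewrite /= -entourage_ballE => -[e e0 eU].
rewrite /nbhs /= -entourage_ballE; exists e => // -[y z] /= yz; apply: eU => /=.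
rewrite -ball_normE /=; apply: (le_lt_trans (lip _ _)).
by rewrite mx_norm_ball in yz.
Qed.

End env_theory.

(** * Stationarity, finite range and ergodicity *)

Section env_measure.
Context {R : realType} {d : nat} (lam r : {posnum R}) (q : R).
Local Notation Env := (Env (d := d) lam r).
Implicit Types (w : Env) (y z : 'rV[R]_d) (F : seq ('rV[R]_d * R)).
Variable nu : {measure set (d.+1.-tuple R) -> \bar R}.
Hypothesis nuE : forall A, (forall i, measurable (A i)) ->
  nu (tbox A) = (\prod_(i < d.+1) (@lebesgue_measure R) (A i))%E.
Variable P : probability Env R.
Hypothesis PE : forall F, levels lam F ->
  P (exceeds F) = (expR (- fine (nu (well_sets r q F))))%:E.

Lemma well_set_place (p : 'rV[R]_d * R) x : 0 < p.2 -> well_set r q p x ->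
  `|p.1 - place x| <= r%:num + p.2.
Proof.
move=> p0 px; apply/rV_norm_leP => [|j]; first by rewrite addr_ge0// ltW.
have := px (lift ord0 j); rewrite /well_box liftK /= in_itv /= !mxE => /andP[h1 h2].
by rewrite ler_norml; apply/andP; split; lra.
Qed.

Definition separated F F' := forall p p', p \in F -> p' \in F' ->
  2 * (r%:num + lam%:num) < `|p.1 - p'.1|.

(** A well that is low at two points has its place close to both of them. *)
Lemma well_sets_disjoint F F' : levels lam F -> levels lam F' -> separated F F' ->
  well_sets r q F `&` well_sets r q F' = set0.
Proof.
move=> lF lF' sep; rewrite -subset0 => x [[p pF px] [p' pF' px']].
have /andP[p0 pl] := lF _ pF; have /andP[p0' pl'] := lF' _ pF'.
have h1 := well_set_place p0 px; have h2 := well_set_place p0' px'.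
have h3 := ler_distD (place x) p.1 p'.1; rewrite (distrC (place x)) in h3.
have := sep _ _ pF pF'.
by move: h1 h2 h3; set s1 := `|_ - _|; set s2 := `|_ - _|; set s3 := `|_ - _|; lra.
Qed.

(** The exponent of the law is a volume, and the volume is additive on
    disjoint sets. *)
Lemma exceeds_independent F F' : levels lam F -> levels lam F' -> separated F F' ->
  P (exceeds F `&` exceeds F') = (P (exceeds F) * P (exceeds F'))%E.
Proof.
move=> lF lF' sep; rewrite exceeds_cat !PE//; last exact: levels_cat.
have -> : well_sets r q (F ++ F') = well_sets r q F `|` well_sets r q F'.
  apply/seteqP; split=> x.
    by move=> [p]; rewrite /= mem_cat => /orP[pF|pF] px; [left|right]; exists p.
  by move=> [[p pF px]|[p pF px]]; exists p => //=; rewrite mem_cat pF ?orbT.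
rewrite measureU//; [|exact: measurable_well_sets|exact: measurable_well_sets|exact: well_sets_disjoint].
have fin G : nu (well_sets r q G) \is a fin_num.
  by rewrite ge0_fin_numE// (well_sets_lty r q nuE).
have -> : fine (nu (well_sets r q F) + nu (well_sets r q F')) =
    fine (nu (well_sets r q F)) + fine (nu (well_sets r q F')) by exact: fineD.
by rewrite opprD expRD EFinM.
Qed.

Lemma translate_well_sets z F :
  nu (well_sets r q (translate z F)) = nu (well_sets r q F).
Proof.
(* The mark coordinate is not translated. *)
pose s (i : 'I_d.+1) : R := if unlift ord0 i is Some j then - z ord0 j else 0.
rewrite -(tuple_measure_shift nuE s (measurable_well_sets r q F)).
congr (nu _).
have E p x : well_set r q (p.1 + z, p.2) x <-> well_set r q p (tshift s x).
  split=> h i; have := h i; rewrite /well_box /tshift tnth_mktuple /s.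
    case: unliftP => [j ->|->]; last by rewrite addr0.
    by rewrite /= !in_itv /= mxE => /andP[h1 h2]; apply/andP; split; lra.
  case: unliftP => [j ->|->]; last by rewrite addr0.
  by rewrite /= !in_itv /= mxE => /andP[h1 h2]; apply/andP; split; lra.
apply/seteqP; split=> x.
  by move=> [_ /mapP[p pF ->] /E px]; exists p.
move=> [p pF /E px]; exists (p.1 + z, p.2) => //.
by apply/mapP; exists p.
Qed.

(** The shift translates the sets of wells, and the volume is invariant under
    translation. *)
Lemma env_shift_measure z (A : set Env) : measurable A -> P (env_shift z @^-1` A) = P A.
Proof.
move=> mA; have [m mE] := pushforward_measure_exists P (measurable_env_shift (r := r) z).
rewrite -mE.
have cI : setI_closed (@env_cylinders R d lam r).
  by rewrite -local_cylinders_setT; exact: local_cylindersI.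
apply: (@measure_unique _ R Env (@env_cylinders R d lam r) (fun=> setT) erefl cI
  _ _ m P _ _ A mA).
- by move=> _; exact: env_cylindersT.
- by rewrite bigcup_const.
- move=> _ [F lF ->]; apply: (etrans (mE _)); rewrite env_shift_exceeds.
  apply: (etrans (PE (levels_translate (z := z) lF))); apply/esym.
  by apply: (etrans (PE lF)); rewrite translate_well_sets.
- by move=> _; rewrite [X in (X < _)%E]mE preimage_setT [X in (X < _)%E]probability_setT ltry.
Qed.

Lemma measure_preserving_env_shift : measure_preserving_action P (env_shift (r := r)).
Proof.
split=> [w|y z w|y|y A mA]; [exact: env_shift0|exact: env_shiftD|exact: measurable_env_shift|].
by rewrite env_shift_image env_shift_measure.
Qed.

Lemma finite_range : finite_range_dependence P (ellipticity (r := r)).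
Proof.
exists (d%:R * (2 * (r%:num + lam%:num)) + 1).
  by rewrite ltr_wpDl// mulr_ge0// mulr_ge0// addr_ge0.
move=> V W VW A B /sigma_field_local sA /sigma_field_local sB.
apply: (@independent_of_pi_systems _ _ _ P (local_cylinders V) (local_cylinders W)) => //.
- exact: local_cylinders_measurable.
- exact: local_cylindersI.
- exact: local_cylindersT.
- exact: local_cylinders_measurable.
- exact: local_cylindersI.
- exact: local_cylindersT.
move=> _ _ [F [lF FV ->]] [F' [lF' FW ->]]; apply: exceeds_independent => // p p' pF pF'.
have : ((d%:R * (2 * (r%:num + lam%:num)) + 1)%:E <= (enorm (p.1 - p'.1))%:E)%E.
  apply: (le_trans VW); apply: ereal_inf_lbound.
  by exists p.1; [exact: FV|exists p'.1 => //; exact: FW].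
rewrite lee_fin => h; rewrite ltNge; apply/negP => h'.
have := le_trans h (enorm_le _).
have : d%:R * `|p.1 - p'.1| <= d%:R * (2 * (r%:num + lam%:num)) by exact: ler_wpM2l.
by set s := _ * `|_|; set t := _ * _; lra.
Qed.

Section ergodicity.
Hypothesis d0 : (0 < d)%N.

Let z n : 'rV[R]_d := const_mx n%:R.

Let separated_translate F F' : exists N, forall n, (N <= n)%N ->
  separated F (translate (z n) F').
Proof.
have bounded (G : seq ('rV[R]_d * R)) : exists M, forall p, p \in G -> `|p.1| <= M.
  elim: G => [|a G [M hM]]; first by exists 0.
  exists (Num.max `|a.1| M) => p; rewrite inE => /orP[/eqP ->|/hM h].
    by rewrite le_max lexx.
  by rewrite le_max h orbT.
have [M hM] := bounded F; have [M' hM'] := bounded F'.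
exists (Num.truncn (`|M| + `|M'| + 2 * (r%:num + lam%:num))).+1 => n Nn p _ pF /mapP[p' pF' ->] /=.
have := truncnS_gt (`|M| + `|M'| + 2 * (r%:num + lam%:num)).
have Nn' : (Num.truncn (`|M| + `|M'| + 2 * (r%:num + lam%:num))).+1%:R <= n%:R :> R by rewrite ler_nat.
move=> /lt_le_trans/(_ Nn') h.
pose j : 'I_d := Ordinal d0.
have := norm_coord_le (p.1 - (p'.1 + z n)) j.
have := norm_coord_le p.1 j; have := norm_coord_le p'.1 j.
have := hM _ pF; have := hM' _ pF'; have := ler_norm M; have := ler_norm M'.
rewrite !mxE !ler_norml; set s := `|_ - _|.
by move=> ? ? ? ? /andP[? ?] /andP[? ?] /andP[? ?]; lra.
Qed.

Let prob (A : set Env) : R := fine (P A).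

Let probE (A : set Env) : measurable A -> P A = (prob A)%:E.
Proof. by move=> mA; rewrite /prob fineK// fin_num_measure. Qed.

Let probD (A B : set Env) : measurable A -> measurable B -> B `<=` A ->
  prob (A `\` B) = prob A - prob B.
Proof.
move=> mA mB BA; have mD := measurableD mA mB.
have : P A = (P (A `\` B) + P B)%E.
  rewrite -measureU//; first by rewrite setUC setDUK.
  by rewrite setDE -setIA setICl setI0.
by rewrite !probE// -EFinD => -[->]; rewrite addrK.
Qed.

Let prob_le (A B : set Env) : measurable A -> measurable B -> A `<=` B -> prob A <= prob B.
Proof. by move=> mA mB AB; rewrite -lee_fin -!probE// le_measure ?inE. Qed.

Let prob_ge0 A : 0 <= prob A.
Proof. exact: fine_ge0. Qed.

Let mshift n (A : set Env) : measurable A -> measurable (env_shift (z n) @^-1` A).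
Proof. by move=> mA; rewrite -[X in measurable X]setTI; exact: measurable_env_shift. Qed.

Let mixing (A : set Env) := forall E, @env_cylinders R d lam r E ->
  prob (E `&` env_shift (z n) @^-1` A) @[n --> \oo] --> prob E * prob A.

(** For cylinders the two events are exactly independent once the shift is
    long enough. The events with the mixing property form a lambda-system: in
    the step to increasing unions the error is uniform in the shift, because
    the shift preserves the measure. *)
Lemma mixing_measurable (A : set Env) : measurable A -> mixing A.
Proof.
have mE E : @env_cylinders R d lam r E -> @measurable _ Env E.
  by move=> cE; exact: sub_sigma_algebra.
suff : <<s @env_cylinders R d lam r >> `<=` [set A | @measurable _ Env A /\ mixing A].
  by move=> h /h[].
have cI : setI_closed (@env_cylinders R d lam r).
  by rewrite -local_cylinders_setT; exact: local_cylindersI.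
apply: (lambda_system_subset cI) => //; last first.
  move=> B cB; split; first exact: mE.
  case: cB => [F' lF' ->] _ [F lF ->].
  have [N hN] := separated_translate F F'.
  apply: cvg_near_cst; exists N => // n /= /hN sep.
  rewrite /prob env_shift_exceeds exceeds_independent//; last exact: levels_translate.
  rewrite fineM ?fin_num_measure//; try by apply: mE; eexists; [|reflexivity]; exact: levels_translate.
  + congr (_ * fine _); rewrite -env_shift_exceeds env_shift_measure//; apply: mE; by exists F'.
  + by apply: mE; exists F.
split => //.
- split => // E cE; rewrite /prob; apply: cvg_near_cst; apply: nearW => n.
  by rewrite preimage_setT setIT probability_setT mulr1.
- move=> B C CB [mB hB] [mC hC]; split; first exact: measurableD.
  move=> E cE; rewrite probD// mulrBr.
  rewrite (_ : (fun n => _) = (fun n => prob (E `&` env_shift (z n) @^-1` B) -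
      prob (E `&` env_shift (z n) @^-1` C))); first by apply: cvgB; [exact: hB|exact: hC].
  apply/funext => n; rewrite -probD.
  + congr prob; apply/seteqP; split=> w /=.
      by move=> [Ew [Bw nCw]]; split => // -[].
    by move=> [[Ew Bw] nCw]; split => //; split => // Cw; apply: nCw.
  + by apply: measurableI; [exact: mE|exact: mshift].
  + by apply: measurableI; [exact: mE|exact: mshift].
  + by apply: setIS => w; exact: CB.
- move=> B' ndB hB; pose B n : set Env := B' n.
  change (nondecreasing_seq B) in ndB.
  change (forall n, @measurable _ Env (B n) /\ mixing (B n)) in hB.
  change (@measurable _ Env (\bigcup_i B i) /\ mixing (\bigcup_i B i)).
  have mB n : @measurable _ Env (B n) by have [] := hB n.
  have mUB : measurable (\bigcup_i B i) by exact: bigcupT_measurable.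
  split => // E cE.
  have lim : prob (B n) @[n --> \oo] --> prob (\bigcup_i B i).
    by apply: fine_cvg; rewrite -probE//; apply: nondecreasing_cvg_mu.
  apply/cvgrPdist_le => e e0.
  have e3 : 0 < e / 3 by rewrite divr_gt0.
  move/cvgrPdist_le : lim => /(_ _ e3)[K _ /(_ K (leqnn K)) hK].
  have [_ /(_ E cE)/cvgrPdist_le/(_ _ e3)[N _ hN]] := hB K.
  exists N => // n /= /hN /=.
  set a := prob (_ `&` _); move=> ha.
  have BK : B K `<=` \bigcup_i B i by exact: bigcup_sup.
  have tail : prob (\bigcup_i B i) - prob (B K) <= e / 3.
    by apply: le_trans hK; exact: ler_norm.
  have tail0 : 0 <= prob (\bigcup_i B i) - prob (B K) by rewrite subr_ge0 prob_le.
  have mEB (A' : set Env) : measurable A' -> @measurable _ Env (E `&` env_shift (z n) @^-1` A').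
    by move=> mA'; apply: measurableI; [exact: mE|exact: mshift].
  have d1 : a <= prob (E `&` env_shift (z n) @^-1` (\bigcup_i B i)).
    by apply: prob_le; [exact: mEB|exact: mEB|apply: setIS => w; exact: BK].
  have d2 : prob (E `&` env_shift (z n) @^-1` (\bigcup_i B i)) - a <=
     prob (\bigcup_i B i) - prob (B K).
    rewrite -!probD//; [|exact: mEB|exact: mEB|by apply: setIS => w; exact: BK].
    rewrite -[leRHS]/(fine _) -(env_shift_measure (z n)); last exact: measurableD.
    apply: prob_le.
    + by apply: measurableD; exact: mEB.
    + by apply: mshift; exact: measurableD.
    + by move=> w /= [[Ew Bw] nw]; split => // BKw; apply: nw.
  have E1 : 0 <= prob E <= 1.
    by rewrite prob_ge0 -lee_fin -probE ?probability_le1//; exact: mE.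
  have d3 : 0 <= prob E * (prob (\bigcup_i B i) - prob (B K)) <= e / 3.
    move/andP: E1 => [E0 E1]; rewrite mulr_ge0//=.
    by apply: le_trans tail; rewrite ler_piMl.
  move: ha d3; rewrite mulrBr !ler_norml => /andP[h1 h2] /andP[h3 h4].
  by apply/andP; split; lra.
Qed.

(** For an invariant event the sequence in the mixing property is constant, so
    that the event is independent of every cylinder, hence of itself. *)
Lemma ergodic_env_shift : ergodic P (env_shift (r := r)).
Proof.
move=> A mA inv.
have invA n : env_shift (z n) @^-1` A = A.
  by have := inv (- z n); rewrite env_shift_image opprK.
have cI : setI_closed (@env_cylinders R d lam r).
  by rewrite -local_cylinders_setT; exact: local_cylindersI.
have cm : @env_cylinders R d lam r `<=` @measurable _ Env by move=> ?; exact: sub_sigma_algebra.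
have AA : P (A `&` A) = (P A * P A)%E.
  apply: (@independent_of_pi_system _ Env R P (@env_cylinders R d lam r) A cm cI
    (@env_cylindersT R d lam r) mA _ A mA) => E cE.
  have mE := cm _ cE; have := mixing_measurable mA cE.
  rewrite (_ : (fun n => _) = cst (prob (E `&` A))); last first.
    by apply/funext => n; rewrite invA.
  move=> /(cvg_unique _ (cvg_cst _)) h.
  by rewrite !probE//; [rewrite h// EFinM|exact: measurableI].
move: AA; rewrite setIid probE// -EFinM => -[] AA.
have /eqP : prob A * (1 - prob A) = 0 by rewrite mulrBr mulr1 -AA subrr.
rewrite mulf_eq0 subr_eq0 => /orP[/eqP ->|/eqP <-]; [by left|by right].
Qed.
End ergodicity.
End env_measure.

(** * The moment bound *)

Lemma powRX (R : realType) (a x : R) n : 0 <= a -> (a ^+ n) `^ x = (a `^ x) ^+ n.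
Proof.
move=> a0; rewrite -(powR_mulrn _ a0) -powRrM mulrC powRrM.
by rewrite powR_mulrn// powR_ge0.
Qed.

Lemma dyadic_bracket (R : realType) (x : R) : 0 < x <= 1 ->
  exists n, 2^-1 ^+ n.+1 < x <= 2^-1 ^+ n.
Proof.
move=> /andP[x0 x1].
have ex : exists m, 2^-1 ^+ m < x.
  have /cvgr_lt/(_ _ x0)[m _ hm] : 2^-1 ^+ m @[m --> \oo] --> (0 : R).
    by apply: cvg_expr; rewrite ger0_norm; lra.
  by exists m; exact: (hm m (leqnn m)).
case: (ex_minnP ex) => [[|n]]; first by rewrite expr0 ltNge x1.
move=> xn /(_ n) h; exists n; rewrite xn leNgt; apply/negP => /h.
by rewrite ltnn.
Qed.

Lemma geometric_lty (R : realType) (a b : R) : 0 <= a -> 0 <= b < 1 ->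
  (\sum_(n <oo) (a * b ^+ n)%:E < +oo)%E.
Proof.
move=> a0 /andP[b0 b1]; rewrite (_ : limn _ = (a * (1 - b)^-1)%:E) ?ltry//.
apply/cvg_lim => //.
rewrite (_ : (fun n => _) = (fun n => (series (geometric a b) n)%:E)); last first.
  by apply/funext => n; rewrite sumEFin.
apply/fine_cvgP; split; first exact: nearW.
by apply: cvg_geometric_series; rewrite ger0_norm.
Qed.

Section env_estimates.
Context {R : realType} {d : nat} (lam r : {posnum R}) (q : R).
Hypotheses (q0 : 0 < q) (lam1 : lam%:num <= 1).
Local Notation Env := (Env (d := d) lam r).
Implicit Types (w : Env) (y z : 'rV[R]_d) (F : seq ('rV[R]_d * R)).
Variable nu : {measure set (d.+1.-tuple R) -> \bar R}.
Hypothesis nuE : forall A, (forall i, measurable (A i)) ->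
  nu (tbox A) = (\prod_(i < d.+1) (@lebesgue_measure R) (A i))%E.
Variable P : probability Env R.
Hypothesis PE : forall F, levels lam F ->
  P (exceeds F) = (expR (- fine (nu (well_sets r q F))))%:E.

Definition well_volume (a : R) : R := a `^ q * (2 * (r%:num + a)) ^+ d.

Lemma well_set_volume y a : 0 < a -> nu (well_set r q (y, a)) = (well_volume a)%:E.
Proof.
move=> a0; rewrite nuE => [|i]; last exact: measurable_well_box.
rewrite big_ord_recl /well_box unlift_none lebesgue_measure_itv /= lte_fin.
rewrite ltrBlDr ltrDl powR_gt0// -EFinB opprB addrC subrK.
rewrite (eq_bigr (fun=> (2 * (r%:num + a))%:E)); last first.
  move=> i _; rewrite liftK lebesgue_measure_itv /= lte_fin.
  have ra : 0 < r%:num + a by rewrite addr_gt0.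
  by rewrite ifT; [rewrite -EFinB; congr EFin; ring|lra].
by rewrite prodEFin -EFinM big_const_ord iter_mulr_1.
Qed.

Lemma exceeds1_law y a : 0 < a < lam%:num ->
  P (exceeds [:: (y, a)]) = (expR (- well_volume a))%:E.
Proof.
move=> /andP[a0 al]; rewrite PE => [|p]; last by rewrite inE => /eqP -> /=; rewrite a0.
rewrite (_ : well_sets r q _ = well_set r q (y, a)) ?well_set_volume//.
apply/seteqP; split=> x; last by move=> h; exists (y, a) => //=; rewrite inE.
by move=> [p]; rewrite /= inE => /eqP ->.
Qed.

Definition deep y (a : R) : set Env := [set w | ellipticity y w <= a].

Lemma measurable_deep y a : measurable (deep y a).
Proof.
rewrite (_ : deep y a = ellipticity y @^-1` `]-oo, a]); last first.
  by apply/seteqP; split=> w /=; rewrite in_itv.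
by rewrite -[X in measurable X]setTI; exact: measurable_ellipticity.
Qed.

(** A value at most a requires a point in a set of volume of order a^q, since
    1 - e^-v <= v. *)
Lemma ellipticity_tail : exists2 C, 0 <= C &
  forall a, 0 < a <= 1 -> (P (deep 0%R a) <= (C * a `^ q)%:E)%E.
Proof.
exists ((2 * (r%:num + 1)) ^+ d + (lam%:num `^ q)^-1).
  by rewrite addr_ge0 ?exprn_ge0 ?invr_ge0 ?powR_ge0 ?mulr_ge0 ?addr_ge0.
move=> a /andP[a0 a1].
have [la|al] := leP lam%:num a.
  apply: (le_trans (probability_le1 _ (measurable_deep _ _))).
  rewrite lee_fin mulrDl; apply: ler_wpDl.
    by rewrite mulr_ge0 ?powR_ge0 ?exprn_ge0 ?mulr_ge0 ?addr_ge0.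
  rewrite ler_pdivlMl ?powR_gt0// mulr1.
  by apply: (ge0_ler_powR (ltW q0)); rewrite ?nnegrE// ltW.
have al' : 0 < a < lam%:num by rewrite a0.
have -> : deep 0 a = ~` exceeds [:: (0, a)].
  apply/seteqP; split=> w /=.
    move=> wa /(_ (0, a)); rewrite inE eqxx => /(_ erefl) /= aw.
    by have := lt_le_trans aw wa; rewrite ltxx.
  move=> h; rewrite /deep /= leNgt; apply/negP => aw; apply: h => p.
  by rewrite inE => /eqP ->.
rewrite probability_setC; last first.
  apply: sub_sigma_algebra; exists [:: (0, a)] => // p.
  by rewrite inE => /eqP ->.
rewrite [X in (1 - X)%E]exceeds1_law// -EFinB lee_fin.
apply: (@le_trans _ _ (well_volume a)).
  by have := expR_ge1Dx (- well_volume a); lra.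
rewrite /well_volume mulrC; apply: ler_wpM2r; first exact: powR_ge0.
apply: ler_wpDr; first by rewrite invr_ge0 powR_ge0.
by rewrite lerXn2r ?nnegrE ?mulr_ge0 ?addr_ge0 ?(ltW a0)// ler_wpM2l// lerD2l.
Qed.

Lemma ellipticity01 y w : 0 < ellipticity y w <= 1.
Proof.
by have [/(_ y)/andP[w0 wl] _ _] := svalP w; rewrite w0 (le_trans wl).
Qed.

(** The negative power is bounded by a sum over dyadic levels of 2^(n p) times
    the indicator of the event that the value is below 2^-n; the latter has
    probability of order 2^(- n q), and p < q. *)
Lemma ellipticity_moment p : p < q -> ('E_P[(fun w => (ellipticity 0 w `^ (- p))%R)] < +oo)%E.
Proof.
move=> pq; pose p' := Num.max p 0.
have p'q : p' < q by rewrite /p' gt_max pq.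
have [C C0 tail] := ellipticity_tail.
pose s : R := 2^-1 `^ (- p'); pose t : R := 2^-1 `^ q.
pose A n : set Env := deep 0 (2^-1 ^+ n).
have mA n : measurable (A n) by exact: measurable_deep.
have s0 : 0 <= s by exact: powR_ge0.
have bound w : ((ellipticity 0 w `^ (- p))%:E <=
    \sum_(n <oo) (s ^+ n.+1 * \1_(A n) w)%:E)%E.
  have [n /andP[n1 n2]] := dyadic_bracket (ellipticity01 0 w).
  have /andP[w0 w1] := ellipticity01 0 w.
  apply: (@le_trans _ _ (s ^+ n.+1 * \1_(A n) w)%:E).
    rewrite lee_fin indicE mem_set//= mulr1.
    apply: (@le_trans _ _ (ellipticity 0 w `^ (- p'))).
      by apply: ger_powR; rewrite ?w0// lerN2 /p' le_max lexx.
    rewrite -powRX// !powRN lef_pV2 ?posrE ?powR_gt0 ?exprn_gt0//.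
    apply: ge0_ler_powR; rewrite ?nnegrE ?(ltW w0) ?(ltW n1) ?exprn_ge0//.
    by rewrite /p' le_max lexx orbT.
  rewrite (nneseriesD1 (n := n))//; last by move=> k _; rewrite lee_fin mulr_ge0 ?exprn_ge0.
  apply: leeDl; apply: nneseries_ge0 => k _ _.
  by rewrite lee_fin mulr_ge0 ?exprn_ge0.
have mterm n : measurable_fun setT (fun w => (s ^+ n.+1 * \1_(A n) w)%:E).
  by apply/measurable_EFinP; apply: measurable_funM => //; exact: measurable_indic.
rewrite unlock; apply: (@le_lt_trans _ _
  (\int[P]_w \sum_(n <oo) (s ^+ n.+1 * \1_(A n) w)%:E)%E).
  apply: ge0_le_integral => //.
  - by move=> w _; rewrite lee_fin powR_ge0.
  - apply/measurable_EFinP.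
    by apply: (measurableT_comp (measurable_powR _)); exact: measurable_ellipticity.
  - apply: (@ge0_emeasurable_sum _ _ _ setT
      (fun n w => (s ^+ n.+1 * \1_(A n) w)%:E) xpredT) => // n w _ _.
    by rewrite lee_fin mulr_ge0 ?exprn_ge0.
rewrite integral_nneseries//; last first.
  by move=> n w _; rewrite lee_fin mulr_ge0 ?exprn_ge0.
apply: (@le_lt_trans _ _ (\sum_(n <oo) ((C * s) * (s * t) ^+ n)%:E)%E).
  apply: lee_nneseries => [n _ _|n _].
    by apply: integral_ge0 => w _; rewrite lee_fin mulr_ge0 ?exprn_ge0.
  under eq_integral do rewrite EFinM.
  rewrite ge0_integralZl//; last 2 first.
  - by apply/measurable_EFinP; exact: measurable_indic.
  - by rewrite lee_fin exprn_ge0.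
  rewrite integral_indic// setIT.
  apply: (@le_trans _ _ ((s ^+ n.+1)%:E * (C * (2^-1 ^+ n) `^ q)%:E)%E).
    apply: lee_wpmul2l; first by rewrite lee_fin exprn_ge0.
    apply: tail; rewrite exprn_gt0//=; apply: exprn_ile1 => //; lra.
  by rewrite -EFinM lee_fin powRX// exprMn exprS /t; lra.
apply: geometric_lty; first by rewrite mulr_ge0.
rewrite mulr_ge0 ?powR_ge0//= /s /t -powRD ?pnatr_eq0 ?invr_eq0; last first.
  by apply/implyP.
rewrite -[ltRHS](powRr0 2^-1).
rewrite /powR ifF ?ifF; try by apply/negbTE; rewrite invr_eq0.
by rewrite ltr_expR mul0r pmulr_rlt0 ?ln_lt0; lra.
Qed.

End env_estimates.

(** * Deep traps close to the origin *)

Lemma powR_half (R : realType) (x : R) : 2^-1 `^ x = (2 `^ x)^-1.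
Proof.
have n0 : 2 `^ x != 0 by rewrite lt0r_neq0// powR_gt0.
by apply: (mulIf n0); rewrite mulVf// -powRM// mulVf// powR1.
Qed.

Section traps.
Context {R : realType} {d : nat} (lam r : {posnum R}) (q : R).
Hypotheses (q0 : 0 < q) (lam1 : lam%:num <= 1) (r2 : 1 <= 2 * r%:num).
Local Notation Env := (Env (d := d) lam r).
Implicit Types (w : Env) (y z : 'rV[R]_d) (F : seq ('rV[R]_d * R)).
Variable nu : {measure set (d.+1.-tuple R) -> \bar R}.
Hypothesis nuE : forall A, (forall i, measurable (A i)) ->
  nu (tbox A) = (\prod_(i < d.+1) (@lebesgue_measure R) (A i))%E.
Variable P : probability Env R.
Hypothesis PE : forall F, levels lam F ->
  P (exceeds F) = (expR (- fine (nu (well_sets r q F))))%:E.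

(** Grid points at this distance see disjoint sets of wells. *)
Definition spacing : R := 2 * (r%:num + lam%:num) + 1.

(** Independent events of equal probability. *)
Lemma exceeds_pairwise a (s : seq 'rV[R]_d) : 0 < a < lam%:num ->
  pairwise (fun y z => 2 * (r%:num + lam%:num) < `|y - z|) s ->
  P (exceeds [seq (y, a) | y <- s]) = (expR (- ((size s)%:R * well_volume r q a (d := d))))%:E.
Proof.
move=> a0; have la t : levels lam [seq (y, a) | y <- t].
  by move=> p /mapP[y _ ->].
elim: s => [_|y s ih] /=.
  rewrite mul0r oppr0 expR0 (_ : exceeds _ = setT) ?probability_setT//.
  by apply/seteqP; split.
move=> /andP[ys /ih {}ih].
rewrite -[(y, a) :: _]cat1s -exceeds_cat.
rewrite (exceeds_independent nuE PE)//; first last.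
- move=> p p'; rewrite inE => /eqP -> /mapP[z zs ->] /=.
  by move/allP : ys => /(_ z zs).
- by move=> p; rewrite inE => /eqP ->.
rewrite ih [X in (X * _)%E](exceeds1_law nuE PE)// -EFinM -expRD; congr (expR _)%:E.
by rewrite -natr1; ring.
Qed.

Definition grid_point n (k : {ffun 'I_d -> 'I_(2 ^ n)}) : 'rV[R]_d :=
  \row_j (spacing * (k j)%:R).

Definition grid n : seq 'rV[R]_d := [seq grid_point k | k : {ffun 'I_d -> 'I_(2 ^ n)}].

Lemma spacing_gt0 : 0 < spacing.
Proof. by rewrite /spacing ltr_wpDl// mulr_ge0// addr_ge0. Qed.

Lemma size_grid n : size (grid n) = ((2 ^ n) ^ d)%N.
Proof. by rewrite size_map -cardE card_ffun !card_ord. Qed.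

Lemma pairwise_grid n :
  pairwise (fun y z => 2 * (r%:num + lam%:num) < `|y - z|) (grid n).
Proof.
rewrite pairwise_map; have := enum_uniq {ffun 'I_d -> 'I_(2 ^ n)}.
rewrite uniq_pairwise; apply: sub_pairwise => k l /= kl.
have [j kj] : exists j, k j != l j.
  apply/existsP; apply: contraNT kl => /existsPn h.
  by apply/eqP/ffunP => j; apply/eqP; have := h j; rewrite negbK.
have := norm_coord_le (grid_point k - grid_point l) j.
apply: lt_le_trans; rewrite !mxE -mulrBr normrM (gtr0_norm spacing_gt0).
apply: (@lt_le_trans _ _ spacing); first by rewrite /spacing ltrDl.
apply: ler_peMr; first exact: ltW spacing_gt0.
have := kj; rewrite -val_eqE /= neq_ltn => /orP[h|h].
  by rewrite distrC; apply: le_trans (ler_norm _); rewrite lerBrDl natr1 ler_nat.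
by apply: le_trans (ler_norm _); rewrite lerBrDl natr1 ler_nat.
Qed.

Lemma norm_grid n y : y \in grid n -> `|y| + spacing <= spacing * 2 ^+ n.
Proof.
move=> /mapP[k _ ->]; rewrite -lerBrDr.
have n1 : (1 <= 2 ^+ n :> R) by rewrite exprn_ege1// ler1n.
apply/rV_norm_leP => [|j].
  by rewrite subr_ge0; apply: ler_peMr => //; exact: ltW spacing_gt0.
have c0 := ltW spacing_gt0.
rewrite mxE ger0_norm ?mulr_ge0//.
rewrite -[X in _ - X]mulr1 -mulrBr; apply: ler_wpM2l => //.
by rewrite lerBrDr -natrX natr1 ler_nat.
Qed.

Section borel_cantelli.
Variables (beta : R) (m0 : nat).
Hypotheses (beta0 : 0 < beta) (betaq : beta * q < d%:R).

(** This is 2^(- beta (n + m0)). The grid below has size 2^n while the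
    macroscopic ball has size of order 2^(n + m0); the offset m0 keeps the
    traps well inside that ball. *)
Definition trap_depth n : R := (2^-1 `^ beta) ^+ (n + m0).

Let base01 : 0 < 2^-1 `^ beta < 1.
Proof.
rewrite powR_gt0//=.
have h2 : 2^-1 < 1 :> R by lra.
have := gt0_ltr_powR beta0 _ _ h2; rewrite powR1; apply; rewrite nnegrE //; lra.
Qed.

Lemma trap_depth_gt0 n : 0 < trap_depth n.
Proof. by rewrite exprn_gt0//; case/andP: base01. Qed.

Let no_trap n : set Env := exceeds [seq (y, trap_depth n) | y <- grid n].

Let mno_trap n : measurable (no_trap n).
Proof.
have [l0|l0] := leP lam%:num (trap_depth n).
  rewrite (_ : no_trap n = set0) //.
  apply/seteqP; split=> // w; rewrite /no_trap /= => h.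
  (* Above the level lam the event is empty, because the grid is not. *)
  have z0 : (0%N < 2 ^ n)%N by rewrite expn_gt0.
  pose k : {ffun 'I_d -> 'I_(2 ^ n)} := [ffun=> Ordinal z0].
  have kin : (grid_point k, trap_depth n) \in [seq (y, trap_depth n) | y <- grid n].
    by apply: map_f; apply/mapP; exists k => //; rewrite mem_enum.
  have /= kw := h _ kin; have [/(_ (grid_point k))/andP[_ wl] _ _] := svalP w.
  by have := lt_le_trans kw (le_trans wl l0); rewrite ltxx.
apply: sub_sigma_algebra; exists [seq (y, trap_depth n) | y <- grid n] => //.
by move=> p /mapP[y _ ->] /=; rewrite trap_depth_gt0.
Qed.

Let rho : R := 2 `^ (d%:R - beta * q).
Let kappa : R := ((2^-1 `^ beta) `^ q) ^+ m0.

Let rho_gt1 : 1 < rho.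
Proof.
have h2 : 1 < 2 :> R by lra.
have e0 : 0 < d%:R - beta * q by rewrite subr_gt0.
by have := gt0_ltr_powR e0 _ _ h2; rewrite powR1; apply; rewrite nnegrE.
Qed.

Let kappa_gt0 : 0 < kappa.
Proof. by rewrite exprn_gt0// powR_gt0// powR_gt0. Qed.

Let no_trap_le n : trap_depth n < lam%:num ->
  (P (no_trap n) <= (kappa^-1 * rho^-1 ^+ n)%:E)%E.
Proof.
move=> hl; rewrite [X in (X <= _)%E]exceeds_pairwise; last exact: pairwise_grid.
  rewrite lee_fin size_grid expRN.
  have E0 : 0 < kappa * rho ^+ n by rewrite mulr_gt0 ?exprn_gt0 ?powR_gt0.
  rewrite exprVn -invfM lef_pV2 ?posrE ?expR_gt0//.
  apply: (@le_trans _ _ (1 + ((2 ^ n) ^ d)%:R * well_volume r q (trap_depth n) (d := d))); last exact: expR_ge1Dx.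
  apply: (@le_trans _ _ (((2 ^ n) ^ d)%:R * trap_depth n `^ q)).
    rewrite /trap_depth powRX; last by case/andP: base01 => /ltW.
    rewrite exprD mulrA [X in X <= _]mulrC ler_wpM2r ?(ltW kappa_gt0)//.
    rewrite -expnM mulnC expnM natrX -exprMn.
    suff -> : rho = (2 ^ d)%:R * (2^-1 `^ beta) `^ q by [].
    rewrite /rho powRD; last by rewrite pnatr_eq0 implybT.
    by rewrite powR_mulrn// natrX powRN -powRrM powR_half.
  rewrite ler_wpDl// ler_wpM2l// /well_volume ler_peMr ?powR_ge0//.
  apply: exprn_ege1; rewrite mulrDr; apply: ler_wpDr => //.
  by rewrite mulr_ge0// ltW// trap_depth_gt0.
by rewrite trap_depth_gt0.
Qed.

Lemma trap_depth_small : \forall n \near \oo, trap_depth n < lam%:num.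
Proof.
have /cvgr_lt : (2^-1 `^ beta) ^+ (n + m0) @[n --> \oo] --> (0 : R).
  rewrite (_ : (fun n => _) = (fun n => (2^-1 `^ beta) ^+ m0 * (2^-1 `^ beta) ^+ n)).
    rewrite -[X in _ --> X](mulr0 ((2^-1 `^ beta) ^+ m0)); apply: cvgMr; apply: cvg_expr.
    by rewrite ger0_norm; [case/andP: base01|exact: powR_ge0].
  by apply/funext => n; rewrite addnC exprD.
exact.
Qed.

(** The chance that no grid point of generation n sees a trap of depth 2^(-
    beta n) is the exponential of minus 2^(n d) * 2^(- n beta q) up to a
    constant. Since beta q < d this is summable, and Borel-Cantelli applies.
    The plateau property then turns the low value at a grid point into a trap
    of radius r. *)
Lemma almost_surely_traps : {ae P, forall w : Env, exists N, forall n, (N <= n)%N ->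
  exists2 x : 'rV[R]_d, `|x| <= spacing * 2 ^+ n &
    forall y, `|y - x| <= r%:num -> ellipticity y w <= trap_depth n}.
Proof.
have [N1 _ hN1] := trap_depth_small.
pose T n := no_trap (n + N1).
exists (lim_sup_set T); split.
- apply: bigcap_measurable; first by exists 0%N.
  by move=> k _; apply: bigcup_measurable => j _; exact: mno_trap.
- apply: lim_sup_set_cvg0 => [k|]; first exact: mno_trap.
  apply: (@le_lt_trans _ _ (\sum_(n <oo) ((kappa^-1 * rho^-1 ^+ N1) * rho^-1 ^+ n)%:E)%E).
    apply: lee_nneseries => // n _.
    apply: (le_trans (no_trap_le _)).
      by apply: hN1 => /=; exact: leq_addl.
    by rewrite lee_fin exprD mulrA mulrAC.
  apply: geometric_lty.
    by rewrite mulr_ge0 ?exprn_ge0 ?invr_ge0 ?powR_ge0 ?(ltW kappa_gt0).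
  rewrite invr_ge0 powR_ge0/= invf_lt1//.
  by apply: lt_trans rho_gt1.
move=> w /= h; apply: contrapT => nT; apply: h.
move: nT => /existsNP[k /not_implyP[_ nT]].
exists (k + N1)%N => n kn.
have wT : ~ no_trap n w.
  move=> nw; apply: nT; exists (n - N1)%N.
    by rewrite /= leq_subRL 1?addnC// (leq_trans _ kn)// leq_addl.
  by rewrite /T subnK// (leq_trans _ kn)// leq_addl.
move: wT => /existsNP[p /not_implyP[/mapP[z zg ->] /= /negP]].
rewrite -leNgt => wz.
have [_ _ /(_ z)[x zx hx]] := svalP w.
exists x; last by move=> y yx; apply: le_trans wz; exact: hx.
apply: le_trans (norm_grid zg).
have xz : `|x| <= `|z| + `|z - x|.
  by rewrite -[X in `|X| <= _](subKr z); exact: ler_normB.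
apply: (le_trans xz); rewrite lerD2l; apply: (le_trans zx); rewrite /spacing.
have r0 : 0 < r%:num by [].
have l0 : 0 < lam%:num by [].
lra.
Qed.
End borel_cantelli.
End traps.

(** * An upper bound for the Pucci operator *)

Section pucci_bound.
Context {R : realType} {d : nat}.
Implicit Types (M N : 'M[R]_d) (e : 'rV[R]_d).

Definition qform M e : R := (e *m M *m e^T) ord0 ord0.

Lemma qformE M e : qform M e = \sum_i \sum_j e ord0 i * e ord0 j * M i j.
Proof.
rewrite /qform mxE exchange_big /=; apply: eq_bigr => j _.
rewrite !mxE mulr_suml; apply: eq_bigr => i _; ring.
Qed.

(** The quadratic form at a combination of two coordinate vectors. *)
Lemma psd_entries N (i j : 'I_d) (a b : R) : psd N ->
  0 <= a ^+ 2 * N i i + b ^+ 2 * N j j - 2 * a * b * N i j.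
Proof.
move=> [NT N0]; have := N0 (a *: delta_mx 0 i - b *: delta_mx 0 j).
have E (k l : 'I_d) : (delta_mx 0 k *m N *m (delta_mx 0 l)^T : 'M[R]_1) ord0 ord0 = N k l.
  by rewrite trmx_delta -rowE -colE !mxE.
have Nji : N j i = N i j by rewrite -[in LHS]NT mxE.
have -> : (a *: delta_mx 0 i - b *: delta_mx 0 j : 'rV[R]_d)^T =
    a *: (delta_mx 0 i)^T - b *: (delta_mx 0 j)^T by rewrite linearB /= !linearZ.
rewrite !mulmxBr !mulmxBl -!scalemxAl -!scalemxAr.
have F A B C D : (A - B - (C - D) : 'M[R]_1) ord0 ord0 =
  A ord0 ord0 - B ord0 ord0 - (C ord0 ord0 - D ord0 ord0) by rewrite !mxE.
have S (c : R) (A : 'M[R]_1) : (c *: A) ord0 ord0 = c * A ord0 ord0 by rewrite mxE.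
rewrite F !S !E Nji => h; apply: le_trans h _; rewrite le_eqVlt; apply/orP; left.
by apply/eqP; ring.
Qed.

(** Twice the difference of the two sides is the sum over all i, j of the
    quadratic form at e_j times the i-th unit vector minus e_i times the j-th
    one. This avoids the spectral theorem. *)
Lemma qform_le_trace N e : psd N -> qform N e <= (\sum_i e ord0 i ^+ 2) * \tr N.
Proof.
move=> psdN; rewrite qformE.
suff : 0 <= \sum_i \sum_j (e ord0 i ^+ 2 * N j j + e ord0 j ^+ 2 * N i i
     - 2 * e ord0 i * e ord0 j * N i j).
  have -> : \sum_i \sum_j (e ord0 i ^+ 2 * N j j + e ord0 j ^+ 2 * N i i
     - 2 * e ord0 i * e ord0 j * N i j) =
     2 * ((\sum_i e ord0 i ^+ 2) * \tr N)
     - 2 * \sum_i \sum_j e ord0 i * e ord0 j * N i j.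
    have -> : (\sum_i e ord0 i ^+ 2) * \tr N = \sum_i \sum_j e ord0 i ^+ 2 * N j j.
      by rewrite mulr_suml; apply: eq_bigr => i _; rewrite mulr_sumr.
    have E : \sum_i \sum_j e ord0 j ^+ 2 * N i i = \sum_i \sum_j e ord0 i ^+ 2 * N j j.
      by rewrite exchange_big.
    rewrite [X in X - _](_ : _ = \sum_i \sum_j e ord0 i ^+ 2 * N j j +
      \sum_i \sum_j e ord0 j ^+ 2 * N i i); last by rewrite E; ring.
    rewrite mulr_sumr -sumrN -!big_split /=.
    apply: eq_bigr => i _; rewrite mulr_sumr -sumrN -!big_split /=.
    by apply: eq_bigr => j _; ring.
  lra.
apply: sumr_ge0 => i _; apply: sumr_ge0 => j _.
have := psd_entries i j (e ord0 j) (e ord0 i) psdN; lra.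
Qed.

Lemma psd_trace_ge0 N : psd N -> 0 <= \tr N.
Proof.
move=> psdN; apply: sumr_ge0 => i _.
by have := psd_entries i i 1 0 psdN; lra.
Qed.

(** The operator is the minimum of - tr (A M) over mu I <= A <= I; the test
    matrix is A = mu I + theta e^T e. The hypothesis 0 <= B accounts for the
    default value of the decomposition, so that no existence of M_+ and M_-
    has to be shown. *)
Lemma pucci_minus_le (mu theta B : R) M e :
  0 <= theta -> theta * (\sum_i e ord0 i ^+ 2) <= 1 - mu ->
  0 <= B -> - (mu * \tr M + theta * qform M e) <= B -> pucci_minus mu M <= B.
Proof.
move=> t0 te B0 MB; rewrite /pucci_minus /pos_neg_parts.
set N := xget _ _.
have : pos_neg_decomp M N \/ N = (0, 0).
  by rewrite /N; case: xgetP => [N' _ ?|_]; [left|right].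
case=> [[psd1 psd2 _ ME]|->]; last by rewrite /= mxtrace0 oppr0 mulr0 addr0.
apply: le_trans MB.
have q1 := qform_le_trace e psd1; have q2 : 0 <= qform N.2 e by have [_ h] := psd2; exact: (h e).
have tr1 := psd_trace_ge0 psd1.
have -> : qform M e = qform N.1 e - qform N.2 e.
  by rewrite /qform ME mulmxBr mulmxBl !mxE.
rewrite ME linearB /=.
have h1 : theta * qform N.1 e <= (1 - mu) * \tr N.1.
  apply: (@le_trans _ _ (theta * ((\sum_i e ord0 i ^+ 2) * \tr N.1))).
    exact: ler_wpM2l.
  by rewrite mulrA; apply: ler_wpM2r.
have h2 : 0 <= theta * qform N.2 e by exact: mulr_ge0.
rewrite !mulrBr; lra.
Qed.
End pucci_bound.

(** * Derivatives of the barrier *)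

Section barrier.
Context {R : realType} {d : nat}.
Variables (eps : R) (x0 : 'rV[R]_d).
Implicit Types (X v : 'rV[R]_d) (i j : 'I_d) (b : R).

Definition zoom i X : R := X ord0 i * eps^-1 - x0 ord0 i.

(** The square of the microscopic distance to x0, regularised by 1 in order
    that all its powers are smooth. *)
Definition zoom_sq X : R := 1 + \sum_i zoom i X ^+ 2.

Definition zoom_pow b X : R := zoom_sq X `^ b.

Lemma zoom_sq_gt0 X : 0 < zoom_sq X.
Proof. by rewrite ltr_pwDl// sumr_ge0// => i _; exact: sqr_ge0. Qed.

Lemma differentiable_zoom i X : differentiable (zoom i) X.
Proof.
have h := @differentiableB R _ _ ((fun N : 'rV[R]_d => N ord0 i) * cst eps^-1) (cst (x0 ord0 i)) X.
apply: h; last exact: differentiable_cst.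
by apply: differentiableM; [exact: differentiable_coord|exact: differentiable_cst].
Qed.

Lemma derive_coord i X v : 'D_v (fun N : 'rV[R]_d => N ord0 i : R) X = v ord0 i.
Proof.
have := derive_mx (@derivable_id R 'rV[R]_d X v).
by rewrite derive_id => /matrixP/(_ ord0 i); rewrite mxE => ->.
Qed.

Lemma is_derive_zoom i j X : is_derive X (delta_mx ord0 j) (zoom i) ((i == j)%:R / eps).
Proof.
apply: DeriveDef; first exact/diff_derivable/differentiable_zoom.
have dc : derivable (fun N : 'rV[R]_d => N ord0 i : R) X (delta_mx ord0 j).
  exact/diff_derivable/differentiable_coord.
have hc : is_derive X (delta_mx ord0 j) (fun N : 'rV[R]_d => N ord0 i : R) (i == j)%:R.
  by apply: DeriveDef => //; rewrite derive_coord mxE eqxx.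
have h := is_deriveB (is_deriveM hc (is_derive_cst (eps^-1) X (delta_mx ord0 j)))
  (is_derive_cst (x0 ord0 i) X (delta_mx ord0 j)).
have [_ ->] := h.
by rewrite scaler0 add0r subr0 /= mulrC.
Qed.

Lemma zoom_sqE : zoom_sq = cst 1 + \sum_i (zoom i * zoom i).
Proof. by apply/funext => X; rewrite /zoom_sq /= fct_sumE. Qed.

Lemma differentiable_zoom_sq X : differentiable zoom_sq X.
Proof.
rewrite zoom_sqE; apply: differentiableD; first exact: differentiable_cst.
by apply: differentiable_sum => i; apply: differentiableM; exact: differentiable_zoom.
Qed.

Lemma derive_zoom_sq j X : 'D_(delta_mx ord0 j) zoom_sq X = 2 * zoom j X / eps.
Proof.
have h i := is_deriveM (is_derive_zoom i j X) (is_derive_zoom i j X).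
have H := is_deriveD (is_derive_cst (1 : R) X (delta_mx ord0 j)) (is_derive_sum h).
have -> : zoom_sq = cst 1 + \sum_i (zoom i * zoom i) by exact: zoom_sqE.
have [_ ->] := H.
rewrite add0r (bigD1 j)//= big1 => [|i /negbTE ij]; last by rewrite ij mul0r scaler0 addr0.
rewrite eqxx addr0 mul1r.
by transitivity (zoom j X * eps^-1 + zoom j X * eps^-1) => //; ring.
Qed.

Lemma differentiable_zoom_pow b X : differentiable (zoom_pow b) X.
Proof.
rewrite (_ : zoom_pow b = (@powR R ^~ b) \o zoom_sq)//; apply: differentiable_comp.
  exact: differentiable_zoom_sq.
apply/derivable1_diffP; apply: ex_derive.
exact: is_derive1_powR (zoom_sq_gt0 X).
Qed.

Lemma is_derive_zoom_pow b j X : is_derive X (delta_mx ord0 j) (zoom_pow b)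
  (b * zoom_pow (b - 1) X * (2 * zoom j X / eps)).
Proof.
apply: DeriveDef; first exact/diff_derivable/differentiable_zoom_pow.
have dp : is_derive (zoom_sq X) 1 (@powR R ^~ b) (b * zoom_sq X `^ (b - 1)).
  exact: is_derive1_powR (zoom_sq_gt0 X).
have dpd : differentiable (@powR R ^~ b) (zoom_sq X).
  by apply/derivable1_diffP; exact: ex_derive.
rewrite deriveE; last exact: differentiable_zoom_pow.
rewrite (_ : zoom_pow b = (@powR R ^~ b) \o zoom_sq)//.
rewrite diff_comp//; last exact: differentiable_zoom_sq.
rewrite /= -(deriveE (delta_mx ord0 j) (differentiable_zoom_sq X)) derive_zoom_sq.
rewrite -[X in 'd _ _ X]mulr1 -[X in 'd _ _ X]/(_ *: _) linearZ /=.
rewrite -deriveE// (@derive_val _ _ _ _ _ _ _ dp).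
by rewrite -[LHS]/(_ * _) mulrC.
Qed.

Variables (a K m : R).

(** In the microscopic variable this is minus a power 2 a < 1 of the distance
    to the trap. For tiny mu the diffusion can be forced to be nearly radial,
    hence nearly one-dimensional, and one-dimensional diffusions find the trap
    wherever they start. *)
Definition barrier X : R := m - K * zoom_pow a X.

Definition barrier1 i X : R :=
  - K * a * 2 / eps * (zoom_pow (a - 1) X * zoom i X).

Definition barrier2 i j X : R :=
  - K * a * 2 / eps * ((a - 1) * zoom_pow (a - 1 - 1) X * (2 * zoom j X / eps) * zoom i X
    + zoom_pow (a - 1) X * ((i == j)%:R / eps)).

Lemma differentiable_barrier X : differentiable barrier X.
Proof.
apply: (@differentiableB R _ _ (cst m) (cst K * zoom_pow a)); first exact: differentiable_cst.
by apply: differentiableM; [exact: differentiable_cst|exact: differentiable_zoom_pow].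
Qed.

Lemma partial_barrier i : partial i barrier = barrier1 i.
Proof.
apply/funext => X; rewrite /partial.
have h := is_deriveB (is_derive_cst m X (delta_mx ord0 i))
  (is_deriveM (is_derive_cst K X (delta_mx ord0 i)) (is_derive_zoom_pow a i X)).
have [_ E] := h; rewrite (_ : barrier = cst m - cst K * zoom_pow a)// E.
by rewrite scaler0 addr0 sub0r /barrier1 -[X in - X]/(_ * _) /=; ring.
Qed.

Lemma differentiable_barrier1 i X : differentiable (barrier1 i) X.
Proof.
apply: (@differentiableM R _ (cst (- K * a * 2 / eps)) (zoom_pow (a - 1) * zoom i)).
  exact: differentiable_cst.
by apply: differentiableM; [exact: differentiable_zoom_pow|exact: differentiable_zoom].
Qed.

Lemma partial_barrier1 i j : partial j (barrier1 i) = barrier2 i j.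
Proof.
apply/funext => X; rewrite /partial.
have h := is_deriveM (is_derive_cst (- K * a * 2 / eps) X (delta_mx ord0 j))
  (is_deriveM (is_derive_zoom_pow (a - 1) j X) (is_derive_zoom i j X)).
have [_ E] := h.
rewrite (_ : barrier1 i = cst (- K * a * 2 / eps) * (zoom_pow (a - 1) * zoom i))// E.
rewrite scaler0 addr0 /barrier2 -[LHS]/(_ * _) /=; congr (_ * _).
by rewrite -[X in X + _]/(_ * _) -[X in _ + X]/(_ * _) addrC mulrC.
Qed.

Lemma differentiable_barrier2 i j X : differentiable (barrier2 i j) X.
Proof.
apply: (@differentiableM R _ (cst (- K * a * 2 / eps))
  ((cst (a - 1) * zoom_pow (a - 1 - 1)) * (cst 2 * zoom j * cst eps^-1) * zoom i
    + zoom_pow (a - 1) * cst ((i == j)%:R / eps))); first exact: differentiable_cst.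
apply: differentiableD; apply: differentiableM.
- apply: differentiableM; apply: differentiableM.
  + exact: differentiable_cst.
  + exact: differentiable_zoom_pow.
  + by apply: differentiableM; [exact: differentiable_cst|exact: differentiable_zoom].
  + exact: differentiable_cst.
- exact: differentiable_zoom.
- exact: differentiable_zoom_pow.
- exact: differentiable_cst.
Qed.

Lemma C2_barrier U : C2_on U barrier.
Proof.
move=> X _; split.
- exact/differentiable_continuous/differentiable_barrier.
- move=> i; rewrite partial_barrier; split.
    exact/diff_derivable/differentiable_barrier.
  exact/differentiable_continuous/differentiable_barrier1.
- move=> i j; rewrite partial_barrier partial_barrier1; split.
    exact/diff_derivable/differentiable_barrier1.
  exact/differentiable_continuous/differentiable_barrier2.
Qed.

Lemma hessian_barrier X : hessian barrier X = \matrix_(i, j) barrier2 i j X.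
Proof.
by apply/matrixP => i j; rewrite !mxE partial_barrier partial_barrier1.
Qed.

End barrier.

(** * Comparison and the lower bound for solutions *)

Section comparison.
Context {R : realType} {d : nat}.
Implicit Types (X : 'rV[R]_d).

Definition sumsq X : R := \sum_i X ord0 i ^+ 2.

Lemma sumsq_ge0 X : 0 <= sumsq X.
Proof. by apply: sumr_ge0 => i _; exact: sqr_ge0. Qed.

Lemma enorm_le1 X : (enorm X <= 1) = (sumsq X <= 1).
Proof. by rewrite /enorm -[X in _ <= X]sqrtr1 ler_sqrt. Qed.

Lemma enorm_lt1 X : (enorm X < 1) = (sumsq X < 1).
Proof. by rewrite /enorm -[X in _ < X]sqrtr1 ltr_sqrt. Qed.

Lemma continuous_sumsq : continuous sumsq.
Proof.
move=> X; apply: differentiable_continuous.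
rewrite (_ : sumsq = \sum_i ((fun N : 'rV[R]_d => N ord0 i) * (fun N : 'rV[R]_d => N ord0 i))).
  by apply: differentiable_sum => i; apply: differentiableM; exact: differentiable_coord.
by apply/funext => Y; rewrite /sumsq fct_sumE.
Qed.

Lemma compact_closed_unit_ball : compact (@closed_unit_ball R d).
Proof.
apply: bounded_closed_compact.
  exists 1; split => // M M1 X; rewrite /closed_unit_ball /= enorm_le1 => X1.
  apply/rV_norm_leP => [|j]; first by rewrite (le_trans ler01)// ltW.
  apply: le_trans (ltW M1); rewrite -(@ler_pXn2r _ 2)// ?nnegrE// expr1n.
  rewrite real_normK ?num_real//; apply: le_trans X1.
  rewrite /sumsq (bigD1 j)//= lerDl; apply: sumr_ge0 => i _; exact: sqr_ge0.
rewrite (_ : closed_unit_ball = sumsq @^-1` [set t | t <= 1]).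
  by apply: closed_comp; [move=> X _; exact: continuous_sumsq|exact: closed_le].
by apply/seteqP; split=> X; rewrite /closed_unit_ball /= enorm_le1.
Qed.

Lemma near_closed_unit_ball X : unit_ball X -> \forall Y \near X, closed_unit_ball Y.
Proof.
rewrite /unit_ball /= enorm_lt1 => X1.
have near1 : \forall Y \near X, sumsq Y < 1 by exact: (cvgr_lt _ (@continuous_sumsq X) _ X1).
near=> Y; rewrite /closed_unit_ball /= enorm_le1 ltW//; near: Y.
exact: near1.
Unshelve. all: by end_near. Qed.

(** At an interior minimum of u - v the function v is a test function from
    below, which contradicts the strict inequality. Hence the minimum sits on
    the sphere. *)
Lemma comparison (mu : 'rV[R]_d -> R) u v :
  dirichlet_solution mu u ->
  (forall X, differentiable v X) -> C2_on unit_ball v ->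
  (forall X, unit_ball X -> pucci_minus (mu X) (hessian v X) < 1) ->
  (forall X, unit_sphere X -> v X <= 0) ->
  v 0 <= u 0.
Proof.
move=> [cu _ usuper u0] dv v2 vlt v0.
have z0 : sumsq 0 = 0.
  by rewrite /sumsq big1// => i _; rewrite mxE expr0n.
have z1 : closed_unit_ball (0 : 'rV[R]_d) by rewrite /closed_unit_ball /= enorm_le1 z0.
have cuv : {within closed_unit_ball, continuous (u \- v)}.
  have cv : {within closed_unit_ball, continuous v}.
    by apply: continuous_subspaceT => Y; exact: differentiable_continuous.
  by move=> X; exact: (continuousB (cu X) (cv X)).
have [X XB Xmin] := compact_EVT_min (ex_intro _ _ z1) compact_closed_unit_ball cuv.
have /(_ 0) := Xmin; rewrite inE => /(_ z1) /= h0.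
rewrite -subr_ge0; apply: le_trans h0; rewrite inE in XB.
have [X1|X1] := ltP (sumsq X) 1.
  exfalso; have UX : unit_ball X by rewrite /unit_ball /= enorm_lt1.
  have lmin : local_min_at (u \- v) X.
    rewrite /local_min_at; near=> Y.
    have YB : closed_unit_ball Y by near: Y; exact: near_closed_unit_ball.
    by apply: Xmin; rewrite inE.
  by have := usuper v X v2 UX lmin; rewrite leNgt vlt.
have SX : unit_sphere X.
  have XB' : enorm X <= 1 by exact: XB.
  by rewrite /unit_sphere /=; apply/eqP; rewrite eq_le XB' /= leNgt enorm_lt1 -leNgt.
by rewrite subr_ge0 u0// v0.
Unshelve. all: by end_near. Qed.
End comparison.

Section lower_bound.
Context {R : realType} {d : nat}.
Variables (eps : R) (x0 : 'rV[R]_d) (a h : R).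
Hypotheses (d0 : (0 < d)%N) (eps0 : 0 < eps) (a0 : 0 < a) (a2 : 2 * a < 1) (h0 : 0 < h).
Implicit Types (X : 'rV[R]_d).

(** The time spent in a trap of microscopic size one and depth h is of order
    eps^2 / h. *)
Definition scale_factor : R := eps ^+ 2 / (2 * d%:R * h).

Local Notation K := scale_factor.

Lemma scale_factor_gt0 : 0 < K.
Proof. by rewrite /K /scale_factor divr_gt0 ?exprn_gt0 ?mulr_gt0 ?ltr0n. Qed.

Definition zoom_sumsq X : R := \sum_i zoom eps x0 i X ^+ 2.
Definition zoom_pow2 X : R := zoom_pow eps x0 (a - 1 - 1) X.
Definition hessian_coef : R := a / (d%:R * h).

Lemma zoom_pow2_gt0 X : 0 < zoom_pow2 X.
Proof. by rewrite /zoom_pow2 /zoom_pow powR_gt0// zoom_sq_gt0. Qed.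

Lemma zoom_sumsq_ge0 X : 0 <= zoom_sumsq X.
Proof. by apply: sumr_ge0 => i _; exact: sqr_ge0. Qed.

Lemma zoom_pow1E X : zoom_pow eps x0 (a - 1) X = (1 + zoom_sumsq X) * zoom_pow2 X.
Proof.
rewrite /zoom_pow2 /zoom_pow -/(zoom_sq eps x0 X); have s0 := zoom_sq_gt0 eps x0 X.
set s := zoom_sq eps x0 X in s0 *.
rewrite -[X in _ = X * _](powRr1 (ltW s0)) -powRD; first by congr powR; ring.
by apply/implyP => _; rewrite gt_eqF.
Qed.

Lemma zoom_pow1_le1 X : (1 + zoom_sumsq X) * zoom_pow2 X <= 1.
Proof.
rewrite -zoom_pow1E /zoom_pow.
have s1 : 1 <= zoom_sq eps x0 X by rewrite /zoom_sq lerDl zoom_sumsq_ge0.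
apply: (@le_trans _ _ (zoom_sq eps x0 X `^ 0)); last by rewrite powRr0.
have a2' := a2; have a0' := a0.
by apply: ler_powR => //; lra.
Qed.

Lemma hessian_coefE : K * a * 2 / eps * (1 / eps) = hessian_coef.
Proof.
rewrite /K /scale_factor /hessian_coef; field.
by rewrite !gt_eqF// ltr0n.
Qed.

Lemma barrier_hessianE m X i j : hessian (barrier eps x0 a K m) X i j =
  - hessian_coef * (2 * (a - 1) * zoom_pow2 X * zoom eps x0 i X * zoom eps x0 j X
         + (1 + zoom_sumsq X) * zoom_pow2 X * (i == j)%:R).
Proof.
rewrite hessian_barrier mxE /barrier2 zoom_pow1E -hessian_coefE -/(zoom_pow2 X).
move: (zoom eps x0 j X) (zoom eps x0 i X) (zoom_pow2 X) (zoom_sumsq X) => zj zi Y s.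
by case: (i == j) => /=; rewrite ?mul0r ?mulr0 ?addr0; ring.
Qed.

Lemma barrier_traceE m X : \tr (hessian (barrier eps x0 a K m) X) =
  - hessian_coef * (2 * (a - 1) * zoom_pow2 X * zoom_sumsq X + d%:R * ((1 + zoom_sumsq X) * zoom_pow2 X)).
Proof.
rewrite /mxtrace (eq_bigr (fun i => - hessian_coef * (2 * (a - 1) * zoom_pow2 X * zoom eps x0 i X ^+ 2
         + (1 + zoom_sumsq X) * zoom_pow2 X))); last first.
  by move=> i _; rewrite barrier_hessianE eqxx mulr1; ring.
rewrite -mulr_sumr big_split /= -mulr_sumr sumr_const card_ord.
by rewrite [d%:R * _]mulr_natl.
Qed.

Lemma barrier_qformE m X : qform (hessian (barrier eps x0 a K m) X) (\row_i zoom eps x0 i X) =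
  - hessian_coef * (2 * (a - 1) * zoom_pow2 X * zoom_sumsq X ^+ 2 + (1 + zoom_sumsq X) * zoom_pow2 X * zoom_sumsq X).
Proof.
rewrite qformE (eq_bigr (fun i => - hessian_coef * (2 * (a - 1) * zoom_pow2 X * zoom_sumsq X
         + (1 + zoom_sumsq X) * zoom_pow2 X) * zoom eps x0 i X ^+ 2)).
  by rewrite -mulr_sumr -/(zoom_sumsq X); ring.
move=> i _; rewrite (eq_bigr (fun j => - hessian_coef * (2 * (a - 1) * zoom_pow2 X) * zoom eps x0 i X ^+ 2
   * zoom eps x0 j X ^+ 2 + - hessian_coef * ((1 + zoom_sumsq X) * zoom_pow2 X) * zoom eps x0 i X *
     (zoom eps x0 j X * (i == j)%:R))); last first.
  by move=> j _; rewrite barrier_hessianE !mxE; move: ((i == j)%:R) => t; ring.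
rewrite big_split /= -!mulr_sumr -/(zoom_sumsq X) (bigD1 i)//= big1 => [|j /negbTE ji].
  by rewrite eqxx mulr1; ring.
by rewrite eq_sym ji mulr0.
Qed.

(** Close to x0 the field is at most h, and A = mu I suffices: the value is of
    order h times scale_factor / eps^2. Farther away the barrier is convex in
    the radial direction; A is the identity in that direction and mu in the
    others, and the radial term wins because mu (d - 1) is smaller than 1 - 2
    a. *)
Lemma pucci_barrier m (mu : R) X : 0 <= mu <= 1 ->
  mu <= (1 - 2 * a) / (2 * d%:R) ->
  (zoom_sumsq X < 2 / (1 - 2 * a) + 1 -> mu <= h) ->
  pucci_minus mu (hessian (barrier eps x0 a K m) X) <= a.
Proof.
move=> /andP[mu0 mu1] mulam mutrap.
have a2' := a2; have a0' := a0.
have d1 : 0 < d%:R :> R by rewrite ltr0n.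
have C0 : 0 < hessian_coef by rewrite /hessian_coef divr_gt0// mulr_gt0.
have s0 := zoom_sumsq_ge0 X; have q0 := zoom_pow2_gt0 X; have qle := zoom_pow1_le1 X.
have [st|st] := ltP (zoom_sumsq X) (2 / (1 - 2 * a) + 1).
  (* Inside the trap the radial part of the Hessian is dropped by its sign. *)
  apply: (@pucci_minus_le _ _ mu 0 a _ 0) => //; rewrite ?mul0r ?subr_ge0 ?(ltW a0)//.
  rewrite addr0 barrier_traceE mulNr mulrN opprK.
  apply: (@le_trans _ _ (h * (hessian_coef * d%:R))); last first.
    by rewrite /hessian_coef le_eqVlt; apply/orP; left; apply/eqP; field; rewrite !gt_eqF.
  apply: (@le_trans _ _ (mu * (hessian_coef * d%:R))); last first.
    by apply: ler_wpM2r; [rewrite mulr_ge0// ltW|exact: mutrap].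
  apply: ler_wpM2l => //; apply: ler_wpM2l; first exact: ltW.
  have : 0 <= (1 - a) * (zoom_pow2 X * zoom_sumsq X) by rewrite !mulr_ge0 ?(ltW q0)//; lra.
  have : d%:R * ((1 + zoom_sumsq X) * zoom_pow2 X) <= d%:R by rewrite ler_piMr.
  lra.
have e0 : 0 < 1 - 2 * a by lra.
have s1 : 0 < zoom_sumsq X.
  by apply: lt_le_trans st; rewrite ltr_wpDl// divr_ge0// ltW.
have rowE : \sum_i (\row_i zoom eps x0 i X) ord0 i ^+ 2 = zoom_sumsq X.
  by apply: eq_bigr => i _; rewrite mxE.
(* theta is such that A has eigenvalue 1 in the radial direction. *)
apply: (@pucci_minus_le _ _ mu ((1 - mu) / zoom_sumsq X) a _ (\row_i zoom eps x0 i X)).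
- by rewrite divr_ge0// subr_ge0.
- by rewrite rowE divfK ?gt_eqF.
- exact: ltW.
apply: (@le_trans _ _ 0); last exact: ltW.
rewrite barrier_traceE barrier_qformE.
have -> : - (mu * (- hessian_coef * (2 * (a - 1) * zoom_pow2 X * zoom_sumsq X + d%:R * ((1 + zoom_sumsq X) * zoom_pow2 X))) +
   (1 - mu) / zoom_sumsq X * (- hessian_coef * (2 * (a - 1) * zoom_pow2 X * zoom_sumsq X ^+ 2 + (1 + zoom_sumsq X) * zoom_pow2 X * zoom_sumsq X))) =
   (hessian_coef * zoom_pow2 X) * (mu * (d%:R - 1) * (1 + zoom_sumsq X) + 1 - (1 - 2 * a) * zoom_sumsq X).
  by field; rewrite gt_eqF.
rewrite pmulr_rle0; last by rewrite mulr_gt0.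
have st' : 2 + (1 - 2 * a) <= (1 - 2 * a) * zoom_sumsq X.
  by move: st; rewrite -(ler_pM2l e0) mulrDr mulr1 mulrCA mulfV ?mulr1// gt_eqF.
have m2 : mu * (2 * d%:R) <= 1 - 2 * a by rewrite -ler_pdivlMr// mulr_gt0.
have : mu * (d%:R - 1) * (1 + zoom_sumsq X) <= (1 - 2 * a) / 2 * (1 + zoom_sumsq X).
  by apply: ler_wpM2r; lra.
lra.
Qed.

Hypotheses (eps8 : 8 * eps ^+ 2 <= 1) (x08 : 8 * eps ^+ 2 * sumsq x0 <= 1).

(** From (s - 2 t)^2 >= 0 follows (s - t)^2 >= s^2 / 2 - t^2. Hence zoom_sq is
    at least 3 / (8 eps^2) on the sphere, if the squared norm of x0 is at most
    1 / (8 eps^2), while it is at most 2 / (8 eps^2) at the centre. *)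
Definition barrier_gain : R := (3 / 8) `^ a - (1 / 4) `^ a.

Lemma barrier_gain_gt0 : 0 < barrier_gain.
Proof.
have q : 1 / 4 < 3 / 8 :> R by lra.
by rewrite subr_gt0; apply: (gt0_ltr_powR a0 _ _ q); rewrite nnegrE; lra.
Qed.

(** The additive constant of the barrier is chosen so that it is nonpositive
    on the sphere; its value at the centre is then a fixed fraction of
    scale_factor * eps^(- 2 a). *)
Lemma solution_lower_bound (mu : 'rV[R]_d -> R) u :
  dirichlet_solution mu u ->
  (forall X, 0 <= mu X <= 1) ->
  (forall X, mu X <= (1 - 2 * a) / (2 * d%:R)) ->
  (forall X, zoom_sumsq X < 2 / (1 - 2 * a) + 1 -> mu X <= h) ->
  K * (barrier_gain * (eps ^- 2) `^ a) <= u 0.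
Proof.
move=> usol mu01 mulam mutrap.
have a2' := a2; have a0' := a0; have eps8' := eps8; have x08' := x08.
have e2 : 0 < eps ^+ 2 by rewrite exprn_gt0.
have e20 : eps ^+ 2 != 0 by rewrite gt_eqF.
pose m := K * ((3 / 8) * eps ^- 2) `^ a.
have K0 := ltW scale_factor_gt0.
have v0 := @comparison R d mu u (barrier eps x0 a K m) usol
  (@differentiable_barrier R d eps x0 a K m) (@C2_barrier R d eps x0 a K m _).
apply: le_trans (v0 _ _); last 2 first.
- move=> X _; apply: (@le_lt_trans _ _ a); last by lra.
  exact: (pucci_barrier m (mu01 X) (mulam X) (mutrap X)).
- move=> X SX; rewrite /barrier subr_le0 /m ler_wpM2l//.
  have X1 : sumsq X = 1.
    move: SX; rewrite /unit_sphere /= => E; apply/eqP; rewrite eq_le -enorm_le1 E lexx /=.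
    by rewrite leNgt -enorm_lt1 E ltxx.
  apply: (ge0_ler_powR (ltW a0)); rewrite ?nnegrE ?mulr_ge0 ?invr_ge0 ?(ltW e2) ?(ltW (zoom_sq_gt0 _ _ _))//.
  rewrite ler_pdivrMr//.
  apply: (@le_trans _ _ ((1 + (eps ^- 2 * sumsq X / 2 - sumsq x0)) * eps ^+ 2)); last first.
    apply: ler_wpM2r; first exact: ltW.
    rewrite /zoom_sq lerD2l -mulrA [sumsq X / 2]mulrC.
    rewrite /sumsq !mulr_sumr -sumrB; apply: ler_sum => i _; rewrite /zoom.
    have -> : eps ^- 2 * (2^-1 * X ord0 i ^+ 2) = 2^-1 * (X ord0 i / eps) ^+ 2.
      by rewrite exprMn exprVn; ring.
    set s := X ord0 i / eps; set t := x0 ord0 i.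
    have := sqr_ge0 (s - 2 * t); rewrite !expr2; lra.
  have -> : (1 + (eps ^- 2 * sumsq X / 2 - sumsq x0)) * eps ^+ 2 =
      eps ^+ 2 + 1 / 2 - eps ^+ 2 * sumsq x0 by rewrite X1; field; rewrite gt_eqF.
  lra.
have p38 : 0 <= 3 / 8 :> R by lra.
have p14 : 0 <= 1 / 4 :> R by lra.
have pe : 0 <= eps ^- 2 by rewrite invr_ge0 ltW.
rewrite /barrier /m -mulrBr ler_wpM2l// /barrier_gain mulrBl lerB//.
  by rewrite (powRM a p38 pe).
rewrite /zoom_pow -(powRM a p14 pe).
apply: (ge0_ler_powR (ltW a0)); rewrite ?nnegrE ?mulr_ge0 ?invr_ge0 ?(ltW e2) ?(ltW (zoom_sq_gt0 _ _ _))//.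
rewrite /zoom_sq ler_pdivlMr// mulrDl mul1r mulr_suml.
rewrite (_ : \sum_i _ = eps ^+ 2 * sumsq x0); first by lra.
by rewrite /sumsq mulr_sumr; apply: eq_bigr => i _; rewrite /zoom mxE mul0r; ring.
Qed.

End lower_bound.

(** * Blow-up of the solutions *)

Section blow_up.
Context {R : realType} {d : nat} (a beta : R) (lam r : {posnum R}).
Local Notation Env := (Env (d := d) lam r).

Lemma trap_sumsq (x : 'rV[R]_d) (c : R) n : `|x| <= c * 2 ^+ n ->
  sumsq x <= d%:R * c ^+ 2 * 4 ^+ n.
Proof.
move=> xc; apply: (@le_trans _ _ (\sum_(i < d) (c * 2 ^+ n) ^+ 2)).
  apply: ler_sum => i _; rewrite -[X in X <= _]real_normK ?num_real//.
  have h := le_trans (norm_coord_le x i) xc.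
  by rewrite lerXn2r ?nnegrE// (le_trans _ h).
have -> : (c * 2 ^+ n) ^+ 2 = c ^+ 2 * 4 ^+ n.
  rewrite exprMn exprAC; congr (_ * _ ^+ n); rewrite expr2; lra.
by rewrite sumr_const card_ord -[X in X <= _]mulr_natl mulrA.
Qed.

Lemma zoom_in_trap (eps : R) (x0 X : 'rV[R]_d) (s : R) : 1 <= s ->
  \sum_i zoom eps x0 i X ^+ 2 < s -> `|eps^-1 *: X - x0| <= s.
Proof.
move=> s1 hs; have s0 : 0 <= s by apply: le_trans s1.
apply/rV_norm_leP => // j.
have -> : (eps^-1 *: X - x0) ord0 j = zoom eps x0 j X by rewrite !mxE /zoom mulrC.
rewrite -(@ler_pXn2r _ 2)// ?nnegrE// real_normK ?num_real//.
apply: (@le_trans _ _ s); last by rewrite expr2 ler_peMr.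
apply: le_trans (ltW hs); rewrite (bigD1 j)//= lerDl.
by apply: sumr_ge0 => i _; exact: sqr_ge0.
Qed.

Hypotheses (d0 : (0 < d)%N) (a0 : 0 < a) (a2 : 2 * a < 1) (beta0 : 0 < beta)
  (ab : 2 < beta + 2 * a).
Hypothesis lamE : lam%:num = (1 - 2 * a) / (2 * d%:R).
Hypothesis rE : r%:num = 2 / (1 - 2 * a) + 1.
Variable m0 : nat.
Hypothesis m0E : 8 * (d%:R * (spacing lam r) ^+ 2) <= 4 ^+ m0.

Definition blow_up_const : R := barrier_gain a / (2 * d%:R * 2 `^ beta).

Lemma blow_up_const_gt0 : 0 < blow_up_const.
Proof.
rewrite /blow_up_const divr_gt0 ?(barrier_gain_gt0 a0)// mulr_gt0 ?powR_gt0//.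
by rewrite mulr_gt0// ltr0n.
Qed.

(** With 2^-k the dyadic scale just above eps, the trap of generation k - m0
    has depth 2^(- beta k) <= (2 eps)^beta, so that the lower bound is of
    order eps^(2 - beta - 2 a). *)
Lemma solution_blow_up (w : Env) N :
  (forall n, (N <= n)%N -> exists2 x : 'rV[R]_d, `|x| <= spacing lam r * 2 ^+ n &
    forall y, `|y - x| <= r%:num -> ellipticity y w <= trap_depth beta m0 n) ->
  forall eps u, 0 < eps -> eps <= 2^-1 ^+ (N + m0).+2 ->
  dirichlet_solution (fun X => ellipticity (eps^-1 *: X) w) u ->
  blow_up_const / eps `^ (beta + 2 * a - 2) <= u 0.
Proof.
move=> traps eps u eps0 epsN usol.
have a0' := a0; have a2' := a2; have d1 : 0 < d%:R :> R by rewrite ltr0n.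
have e1 : eps <= 1.
  by apply: (le_trans epsN); apply: exprn_ile1 => //; lra.
have eps4 : eps <= 4^-1.
  apply: (le_trans epsN); rewrite !exprS mulrA (_ : 2^-1 * 2^-1 = 4^-1 :> R); last by field.
  by rewrite ler_piMr//; apply: exprn_ile1 => //; lra.
have [k /andP[k1 k2]] : exists n, 2^-1 ^+ n.+1 < eps <= 2^-1 ^+ n.
  by apply: dyadic_bracket; rewrite eps0.
have Nk : (N + m0 <= k)%N.
  rewrite leqNgt; apply/negP => kN.
  have : 2^-1 ^+ (N + m0).+2 <= 2^-1 ^+ k.+1 :> R.
    apply: ler_wiXn2l => //; first by lra.
    by rewrite ltnS; apply: leq_trans (leqnSn _); exact: ltnW.
  by move=> /(le_trans epsN)/(lt_le_trans k1); rewrite ltxx.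
have [n nE] : exists n, k = (n + m0)%N.
  by exists (k - m0)%N; rewrite subnK// (leq_trans _ Nk)// leq_addl.
have Nn : (N <= n)%N by rewrite nE leq_add2r in Nk.
have [x xn hx] := traps n Nn.
have h0 : 0 < trap_depth beta m0 n by exact: trap_depth_gt0.
have hle : trap_depth beta m0 n <= (2 * eps) `^ beta.
  rewrite /trap_depth -nE -powRX//; apply: (ge0_ler_powR (ltW beta0)).
  - by rewrite nnegrE exprn_ge0.
  - by rewrite nnegrE mulr_ge0// ltW.
  - by move: k1; rewrite exprS; move: (2^-1 ^+ k) => t; lra.
have xs := trap_sumsq xn.
have eps2 : eps ^+ 2 <= 4^-1 ^+ k.
  rewrite (_ : 4^-1 = 2^-1 ^+ 2 :> R); last by rewrite expr2; field.
  by rewrite exprAC lerXn2r// nnegrE ?exprn_ge0// ltW.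
have x8 : 8 * eps ^+ 2 * sumsq x <= 1.
  apply: (@le_trans _ _ (4^-1 ^+ k * (8 * (d%:R * spacing lam r ^+ 2) * 4 ^+ n))).
    have -> : 8 * eps ^+ 2 * sumsq x = eps ^+ 2 * (8 * sumsq x) by ring.
    apply: ler_pM => //; first exact: sqr_ge0.
      by rewrite mulr_ge0// sumsq_ge0.
    by rewrite -mulrA ler_wpM2l.
  apply: (@le_trans _ _ (4^-1 ^+ k * (4 ^+ m0 * 4 ^+ n))).
    by apply: ler_wpM2l; [rewrite exprn_ge0|apply: ler_wpM2r; rewrite ?exprn_ge0].
  by rewrite -exprD addnC -nE -exprMn mulVf ?expr1n.
have e8 : 8 * eps ^+ 2 <= 1.
  rewrite expr2; have : eps * eps <= 4^-1 * 4^-1 by apply: ler_pM => //; exact: ltW.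
  lra.
apply: le_trans (solution_lower_bound d0 eps0 a0 a2 h0 e8 x8 usol _ _ _); first last.
- move=> X hX; apply: hx; apply: zoom_in_trap; first by rewrite rE lerDr divr_ge0//; lra.
  by rewrite rE.
- move=> X; rewrite -lamE; by have [/(_ (eps^-1 *: X))/andP[]] := svalP w.
- move=> X; have [/(_ (eps^-1 *: X))/andP[w0 wl] _ _] := svalP w.
  rewrite (ltW w0)/=; apply: (le_trans wl); rewrite lamE ler_pdivrMr ?mulr_gt0//.
  have : 1 <= d%:R :> R by rewrite ler1n.
  lra.
rewrite /blow_up_const /scale_factor.
have pe : 0 < (2 * eps) `^ beta by rewrite powR_gt0// mulr_gt0.
apply: (@le_trans _ _ (eps ^+ 2 / (2 * d%:R * (2 * eps) `^ beta) * (barrier_gain a * (eps ^- 2) `^ a))); last first.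
  apply: ler_wpM2r.
    by rewrite mulr_ge0 ?powR_ge0// ltW// barrier_gain_gt0.
  apply: ler_wpM2l; first by rewrite exprn_ge0// ltW.
  by rewrite lef_pV2 ?posrE ?mulr_gt0// ler_wpM2l// mulr_ge0// ltW.
rewrite le_eqVlt; apply/orP; left; apply/eqP.
have -> : (eps ^- 2) `^ a = (eps `^ (2 * a))^-1.
  rewrite -powR_invn ?(ltW eps0)// -powRrM -powRN; congr (_ `^ _); ring.
rewrite powRM ?(ltW eps0)//.
have -> : eps `^ (beta + 2 * a - 2) = eps `^ beta * eps `^ (2 * a) / eps ^+ 2.
  rewrite powRB; last by apply/implyP => _; rewrite gt_eqF.
  rewrite powRD; last by apply/implyP => _; rewrite gt_eqF.
  by rewrite powR_mulrn// ltW.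
have b1 : eps `^ beta != 0 by rewrite gt_eqF// powR_gt0.
have b2 : eps `^ (2 * a) != 0 by rewrite gt_eqF// powR_gt0.
have b3 : 2 `^ beta != 0 :> R by rewrite gt_eqF// powR_gt0.
have b4 : eps != 0 by rewrite gt_eqF.
have b5 : d%:R != 0 :> R by rewrite gt_eqF.
field; by rewrite b1 b2 b3 b4 b5.
Qed.

Lemma cvg_solution_blow_up (w : Env) :
  (exists N, forall n, (N <= n)%N ->
    exists2 x : 'rV[R]_d, `|x| <= spacing lam r * 2 ^+ n &
    forall y, `|y - x| <= r%:num -> ellipticity y w <= trap_depth beta m0 n) ->
  forall u : R -> 'rV[R]_d -> R,
  (forall eps, 0 < eps -> dirichlet_solution (fun X => ellipticity (eps^-1 *: X) w) (u eps)) ->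
  u eps 0 @[eps --> 0^'+] --> +oo.
Proof.
move=> [N traps] u usol; apply/cvgryPge => A.
have g0 : 0 < beta + 2 * a - 2 by rewrite subr_gt0.
have A0 : 0 < blow_up_const / (`|A| + 1).
  by rewrite divr_gt0 ?blow_up_const_gt0// ltr_wpDl.
have small : \forall eps \near 0^'+, eps `^ (beta + 2 * a - 2) < blow_up_const / (`|A| + 1).
  exact: (cvgr_lt _ (powR_cvg0 g0) _ A0).
near=> eps.
have eps0 : 0 < eps by near: eps; exact: nbhs_right_gt.
have epsN : eps <= 2^-1 ^+ (N + m0).+2.
  by near: eps; apply: nbhs_right_le; rewrite exprn_gt0.
apply: le_trans (solution_blow_up traps eps0 epsN (usol eps eps0)).
have pe : 0 < eps `^ (beta + 2 * a - 2) by rewrite powR_gt0.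
have A1 : 0 < `|A| + 1 by rewrite ltr_wpDl.
have small' : eps `^ (beta + 2 * a - 2) < blow_up_const / (`|A| + 1) by near: eps.
apply: (@le_trans _ _ (`|A| + 1)); first by rewrite ler_wpDr// ler_norm.
by rewrite ler_pdivlMr// mulrC -ler_pdivlMr// ltW.
Unshelve. all: by end_near. Qed.
End blow_up.

Theorem mainTheorem4 (R : realType) (d : nat) (hd : (1 <= d)%N) (p : R)
    (hp : p < d%:R) :
  exists (disp : measure_display) (Omega : measurableType disp)
    (P : probability Omega R)
    (tau : 'rV[R]_d -> Omega -> Omega)
    (lambda : 'rV[R]_d -> Omega -> R),
    [/\ measure_preserving_action P tau,
        ergodic P tau,
        forall y, measurable_fun setT (lambda y),
        forall y w, 0 < lambda y w <= 1 &
        stationary tau lambda] /\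
    [/\ {ae P, forall w, unif_continuous (fun y => lambda y w)},
        finite_range_dependence P lambda,
        ('E_P[(fun w => (lambda 0 w `^ (- p))%R)] < +oo)%E &
        {ae P, forall w, forall u : R -> 'rV[R]_d -> R,
          (forall eps : R, 0 < eps ->
            dirichlet_solution (fun x => lambda (eps^-1 *: x) w) (u eps)) ->
          u eps 0 @[eps --> 0^'+] --> +oo}].
Proof.
have d0 : 0 < d%:R :> R by rewrite ltr0n.
have d1 : 1 <= d%:R :> R by rewrite ler1n.
pose p' := Num.max p 0.
have p'd : p' < d%:R by rewrite /p' gt_max hp.
have p'0 : 0 <= p' by rewrite /p' le_max lexx orbT.
have pp' : p <= p' by rewrite /p' le_max lexx.
(* The exponents: p < q < d for the tail of the field, 1 < beta < d / q for the
   depth of the traps, and 2 - beta < 2 a < 1 for the barrier. *)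
pose q : R := (p' + d%:R) / 2.
have q0 : 0 < q by rewrite /q; lra.
have pq : p < q by rewrite /q; lra.
have qd : q < d%:R by rewrite /q; lra.
pose beta : R := (1 + d%:R / q) / 2.
have dq1 : 1 < d%:R / q by rewrite ltr_pdivlMr// mul1r.
have beta1 : 1 < beta by rewrite /beta; lra.
have beta0 : 0 < beta by lra.
have betaq : beta * q < d%:R.
  have -> : beta * q = (q + d%:R) / 2 by rewrite /beta; field; rewrite gt_eqF.
  lra.
pose c := Num.max (2 - beta) 0.
have c1 : c < 1 by rewrite /c gt_max; apply/andP; split; lra.
have c0 : 0 <= c by rewrite /c le_max lexx orbT.
have cb : 2 - beta <= c by rewrite /c le_max lexx.
pose a : R := (c + 1) / 4.
have a0 : 0 < a by rewrite /a; lra.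
have a2 : 2 * a < 1 by rewrite /a; lra.
have ab : 2 < beta + 2 * a by rewrite /a; lra.
have lam0 : 0 < (1 - 2 * a) / (2 * d%:R) by rewrite divr_gt0 ?mulr_gt0//; lra.
have r0 : 0 < 2 / (1 - 2 * a) + 1 by rewrite ltr_wpDl// divr_ge0//; lra.
(* The field is at most lam, which makes the barrier a subsolution away from
   the trap, and r is the radius of the region near x0 where it is concave. *)
pose lam : {posnum R} := PosNum lam0; pose r : {posnum R} := PosNum r0.
have lam1 : lam%:num <= 1 by rewrite /lam /= ler_pdivrMr ?mulr_gt0//; lra.
have r2 : 1 <= 2 * r%:num.
  have : 0 <= 2 / (1 - 2 * a) by rewrite divr_ge0//; lra.
  by rewrite /r /=; lra.
have [m0 m0E] : exists m0, 8 * (d%:R * (spacing lam r) ^+ 2) <= 4 ^+ m0.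
  set B := 8 * _; exists (Num.truncn B).+1; apply: (le_trans (ltW (truncnS_gt B))).
  rewrite -natrX ler_nat; apply: ltnW; exact: ltn_expl.
have [nu nuE] := lebesgue_tuple_exists (R := R) d.+1.
have [P PE] := env_law_exists r q0 lam1 nuE.
exists _, (Env (d := d) lam r), P, (env_shift (r := r)), (ellipticity (r := r)).
split; split.
- exact: (measure_preserving_env_shift nuE PE).
- exact: (ergodic_env_shift nuE PE hd).
- exact: measurable_ellipticity.
- by move=> y w; exact: (ellipticity01 lam1).
- by [].
- by apply: aeW => w; exact: unif_continuous_ellipticity.
- exact: (finite_range nuE PE).
- exact: (ellipticity_moment q0 lam1 nuE PE pq).
- have [N [mN PN subN]] := almost_surely_traps r2 nuE PE m0 beta0 betaq.
  exists N; split => // w /= nw; apply: subN => /= traps; apply: nw.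
  exact: (@cvg_solution_blow_up R d a beta lam r hd a0 a2 beta0 ab erefl erefl
    m0 m0E w traps).
Qed.
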